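(* Let $\Bbbk$ be a field of characteristic zero and let $\mathfrak g=\bigoplus_{i\ge1}L_i$ be a finite-dimensional positively graded metabelian Lie algebra over $\Bbbk$ generated by $L_1$; put $\mathfrak d=\mathfrak g'=\bigoplus_{i\ge2}L_i$. Restriction of cocycles induces a well-defined map $$\Delta_{\mathfrak g}:H^2_0(\mathfrak g;\mathfrak g)\longrightarrow\operatorname{Hom}(\Lambda^2\mathfrak d,\mathfrak g)_0,\qquad \Delta_{\mathfrak g}[\phi]=\phi|_{\Lambda^2\mathfrak d}.$$ Its kernel is the tangent space to graded metabelian deformations of $\mathfrak g$ modulo infinitesimal graded equivalence: $$\ker\Delta_{\mathfrak g}=\frac{Z^2_0(\mathfrak g;\mathfrak g)\cap\ker(\operatorname{res}_{\Lambda^2\mathfrak d})}{B^2_0(\mathfrak g;\mathfrak g)}.$$ Let $U=L_1$, $R=\operatorname{Sym}(U)$, and suppose $\mathfrak g$ corresponds to the graded $R$-module quotient $q:B(U)\twoheadrightarrow C$ with kernel $N$ (so $\mathfrak g\simeq M(U)/N$ and $C\simeq\mathfrak g'$), with graded rank vector $h_r=\dim C_r$. Then there is a natural identification $$\ker\Delta_{\mathfrak g}\simeq H^0\bigl(T_q[Q_h/\operatorname{GL}(U)]\bigr)\simeq\operatorname{coker}\Bigl(\mathfrak{gl}(U)\xrightarrow{\mathrm d\operatorname{orb}_q}\operatorname{Hom}_R(N,C)_0\Bigr).$$ Moreover, $H^{-1}\bigl(T_q[Q_h/\operatorname{GL}(U)]\bigr)\simeq\operatorname{Der}_0(\mathfrak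 g)$, the space of degree-zero derivations of $\mathfrak g$.
   Context: Metabelian means $[\mathfrak g',\mathfrak g']=0$. $C^q(\mathfrak g;\mathfrak g)=\operatorname{Hom}(\Lambda^q\mathfrak g,\mathfrak g)$ is the adjoint Chevalley–Eilenberg complex; the subscript $0$ denotes degree-zero maps (preserving total degree); $Z^q_0$, $B^q_0$, $H^q_0$ are the degree-zero cocycles, coboundaries, cohomology. $\operatorname{res}_{\Lambda^2\mathfrak d}$ is restriction of a 2-cochain to $\Lambda^2\mathfrak d$. A first-order graded metabelian deformation of the bracket $\mu$ is a graded bracket $\mu+\epsilon\phi$ over $\Bbbk[\epsilon]/(\epsilon^2)$ ($\phi$ of degree zero) satisfying Jacobi and the metabelian identity. Free metabelian Lie algebra: $M(U)=\operatorname{Lie}(U)/\operatorname{Lie}(U)''$, $B(U)=M(U)'$, an $R$-module via $u\cdot b=[u,b]$, graded internally so that $[u,v]$ ($u,v\in U$) has degree $0$; internal degree $r$ is Lie degree $r+2$. The universal map $M(U)\twoheadrightarrow\mathfrak g$, the identity on $U=L_1$, has homogeneous kernel $N\subset B(U)$, an $R$-submodule, and $C=B(U)/N$. $Q_h$ is the graded Quot scheme: $Q_h(A)$ is the set of homogeneous quotients $A\otimes B(U)\twoheadrightarrow C_A$ of $\operatorname{Sym}_A(A\otimes U)$-modules with $(C_A)_r$ finite projective of rank $h_r$, up to isomorphism of the target. $\operatorname{GL}(U)$ acts by $a\cdot q=q\circ\widetilde a^{-1}$ with $\widetilde a$ the induced automorphism of $B(U)$. The tangent complex at $q$ is $T_q[Q_h/\operatorname{GL}(U)]=[\mathfrak{gl}(U)\xrightarrow{\mathrm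 d\operatorname{orb}_q}\operatorname{Hom}_R(N,C)_0]$ with $\mathfrak{gl}(U)$ in degree $-1$, where $\operatorname{Hom}_R(N,C)_0$ denotes degree-zero $R$-linear maps and $(\mathrm d\operatorname{orb}_q a)(n)=q(\widetilde a n)$ for $n\in N$, $\widetilde a$ now denoting the infinitesimal action (degree-zero derivation of $M(U)$ induced by $a$) on $B(U)$. *)

(* Defs.v *)
From HB Require Import structures.
From mathcomp Require Import all_boot all_order all_algebra.
From mathcomp Require Import boolp functions mpoly.

Set Implicit Arguments.
Unset Strict Implicit.
Unset Printing Implicit Defensive.

Import GRing.Theory.
Local Open Scope ring_scope.
Local Open Scope quotient_scope.

Record subsp (k : fieldType) (V : lmodType k) := Subsp {
  subsp_prop :> V -> Prop;
  subsp0 : subsp_prop 0;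
  subspD : forall x y, subsp_prop x -> subsp_prop y -> subsp_prop (x + y);
  subspZ : forall a x, subsp_prop x -> subsp_prop (a *: x)
}.

Section SubQuot.
Variables (k : fieldType) (V : lmodType k).
Implicit Type W : subsp V.

Definition subsp_pred W : {pred V} := fun x => `[< W x >].

Lemma subspE W x : (x \in subsp_pred W) <-> W x.
Proof. by rewrite unfold_in; split=> /asboolP. Qed.

Lemma subsp_pred_closed W : submod_closed (subsp_pred W).
Proof.
split; first by apply/subspE; exact: subsp0.
move=> a x y /subspE hx /subspE hy; apply/subspE.
by apply: subspD => //; apply: subspZ.
Qed.

HB.instance Definition _ W :=
  GRing.isSubmodClosed.Build k V (subsp_pred W) (subsp_pred_closed W).

Definition subT W := {x : V | x \in subsp_pred W}.
HB.instance Definition _ W := SubType.on (subT W).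
HB.instance Definition _ W := Choice.on (subT W).
HB.instance Definition _ W := [SubChoice_isSubLmodule of subT W by <:].

Lemma subTP W (x : subT W) : W (val x).
Proof. by apply/subspE; exact: valP. Qed.

Definition inSub W (x : V) (h : W x) : subT W := exist _ x (proj2 (subspE W x) h).

Definition quotT W := Quotient.quot (subsp_pred W).
HB.instance Definition _ W := GRing.Zmodule.on (quotT W).
HB.instance Definition _ W := EqQuotient.on (quotT W).

Lemma quotP W (x y : V) : \pi_(quotT W) x = \pi_(quotT W) y <-> W (x - y).
Proof.
split=> [/eqP|h]; first by rewrite -Quotient.idealrBE => /subspE.
by apply/eqP; rewrite -Quotient.idealrBE; apply/subspE.
Qed.

Lemma quot_piD W : {morph \pi_(quotT W) : x y / x + y}.
Proof. by move=> x y /=; rewrite [RHS]piE. Qed.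

Lemma quot_reprP W (x : V) : W (repr (\pi_(quotT W) x) - x).
Proof. by apply/quotP; rewrite reprK. Qed.

Definition quot_scale W (a : k) (c : quotT W) : quotT W := \pi_(quotT W) (a *: repr c).

Lemma quot_piZ W a x : quot_scale a (\pi_(quotT W) x) = \pi_(quotT W) (a *: x).
Proof.
by apply/quotP; rewrite -scalerBr; apply: subspZ; exact: quot_reprP.
Qed.

Lemma quot_ind W (P : quotT W -> Prop) : (forall x, P (\pi_(quotT W) x)) -> forall c, P c.
Proof. by move=> h c; rewrite -[c]reprK; exact: h. Qed.

Fact quot_scaleA W a b (v : quotT W) :
  quot_scale a (quot_scale b v) = quot_scale (a * b) v.
Proof. by elim/quot_ind: v => v; rewrite !quot_piZ scalerA. Qed.
Fact quot_scale1 W : left_id 1 (@quot_scale W).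
Proof. by elim/quot_ind=> v; rewrite quot_piZ scale1r. Qed.
Fact quot_scaleDr W : right_distributive (@quot_scale W) +%R.
Proof.
move=> a; elim/quot_ind=> x; elim/quot_ind=> y.
by rewrite -quot_piD !quot_piZ scalerDr quot_piD.
Qed.
Fact quot_scaleDl W v : {morph (@quot_scale W)^~ v : a b / a + b}.
Proof. by move=> a b /=; elim/quot_ind: v => v; rewrite !quot_piZ scalerDl quot_piD. Qed.

HB.instance Definition _ W := GRing.Zmodule_isLmodule.Build k (quotT W)
  (@quot_scaleA W) (@quot_scale1 W) (@quot_scaleDr W) (@quot_scaleDl W).

Definition quot_proj W (x : V) : quotT W := \pi_(quotT W) x.
Fact quot_proj_linear W : linear (@quot_proj W).
Proof. by move=> a x y; rewrite /quot_proj quot_piD -quot_piZ. Qed.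
HB.instance Definition _ W :=
  GRing.isLinear.Build k V (quotT W) _ (@quot_proj W) (@quot_proj_linear W).

End SubQuot.

Arguments quot_proj {k V} W x.

Lemma proj_ind (k : fieldType) (V : lmodType k) (W : subsp V) (P : quotT W -> Prop) :
  (forall x, P (quot_proj W x)) -> forall c, P c.
Proof. by move=> h; elim/quot_ind=> x; exact: h. Qed.

Lemma projP (k : fieldType) (V : lmodType k) (W : subsp V) (x y : V) :
  quot_proj W x = quot_proj W y <-> W (x - y).
Proof. exact: quotP. Qed.

Section Subspaces.
Variables (k : fieldType) (V W : lmodType k).

Definition fullsp : subsp V :=
  @Subsp k V (fun=> True) I (fun _ _ _ _ => I) (fun _ _ _ => I).

Section Span.
Variable S : V -> Prop.
Definition span_prop (x : V) : Prop :=
  forall X : subsp V, (forall y, S y -> X y) -> X x.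
Fact span0 : span_prop 0. Proof. by move=> X _; exact: subsp0. Qed.
Fact spanD x y : span_prop x -> span_prop y -> span_prop (x + y).
Proof. by move=> hx hy X hX; apply: subspD; [exact: hx|exact: hy]. Qed.
Fact spanZ a x : span_prop x -> span_prop (a *: x).
Proof. by move=> hx X hX; apply: subspZ; exact: hx. Qed.
Definition span : subsp V := Subsp span0 spanD spanZ.
End Span.

Section LinearMaps.
Variable f : {linear V -> W}.

Fact ker0 : f 0 = 0. Proof. exact: linear0. Qed.
Fact kerD x y : f x = 0 -> f y = 0 -> f (x + y) = 0.
Proof. by rewrite linearD => -> ->; rewrite addr0. Qed.
Fact kerZ a x : f x = 0 -> f (a *: x) = 0.
Proof. by rewrite linearZ /= => ->; rewrite scaler0. Qed.
Definition ker : subsp V := Subsp ker0 kerD kerZ.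

Definition image_prop (X : subsp V) (y : W) : Prop := exists2 x, X x & y = f x.
Fact image0 X : image_prop X 0.
Proof. by exists 0; [exact: subsp0|rewrite linear0]. Qed.
Fact imageD X x y : image_prop X x -> image_prop X y -> image_prop X (x + y).
Proof.
move=> [x' hx ->] [y' hy ->]; exists (x' + y'); first exact: subspD.
by rewrite linearD.
Qed.
Fact imageZ X a x : image_prop X x -> image_prop X (a *: x).
Proof.
by move=> [x' hx ->]; exists (a *: x'); [exact: subspZ|rewrite linearZ].
Qed.
Definition image (X : subsp V) : subsp W := Subsp (image0 X) (@imageD X) (@imageZ X).

Fact preim0 (Y : subsp W) : Y (f 0). Proof. by rewrite linear0; exact: subsp0. Qed.
Fact preimD (Y : subsp W) x y : Y (f x) -> Y (f y) -> Y (f (x + y)).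
Proof. by rewrite linearD; exact: subspD. Qed.
Fact preimZ (Y : subsp W) a x : Y (f x) -> Y (f (a *: x)).
Proof. by rewrite linearZ /=; exact: subspZ. Qed.
Definition preim (Y : subsp W) : subsp V := Subsp (preim0 Y) (@preimD Y) (@preimZ Y).

Definition coker : lmodType k := quotT (image fullsp).
End LinearMaps.

Definition has_dim (n : nat) : Prop := exists f : {linear 'rV[k]_n -> V}, bijective f.

End Subspaces.

Arguments fullsp {k V}.
Arguments has_dim {k} V n.

Record lieBracket (k : fieldType) (V : lmodType k) := LieBracket {
  lie_br :> V -> V -> V;
  lie_linl : forall y, linear (lie_br^~ y);
  lie_linr : forall x, linear (lie_br x);
  lie_alt : forall x, lie_br x x = 0;
  lie_jacobi : forall x y z,
    lie_br x (lie_br y z) + lie_br y (lie_br z x) + lie_br z (lie_br x y) = 0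
}.

Arguments lie_br : simpl never.

Section Lie.
Variables (k : fieldType) (V : lmodType k) (mu : lieBracket V).
Implicit Types (x y z : V) (X Y : subsp V).

Lemma lieDl x y z : mu (x + y) z = mu x z + mu y z.
Proof. by have := lie_linl mu z 1 x y; rewrite /= !scale1r. Qed.
Lemma lieDr x y z : mu x (y + z) = mu x y + mu x z.
Proof. by have := lie_linr mu x 1 y z; rewrite /= !scale1r. Qed.
Lemma lie0l z : mu 0 z = 0.
Proof. by apply: (@addrI _ (mu 0 z)); rewrite -lieDl !addr0. Qed.
Lemma lie0r z : mu z 0 = 0.
Proof. by apply: (@addrI _ (mu z 0)); rewrite -lieDr !addr0. Qed.
Lemma lieZl a x z : mu (a *: x) z = a *: mu x z.
Proof. by have := lie_linl mu z a x 0; rewrite /= lie0l !addr0. Qed.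
Lemma lieZr a x z : mu x (a *: z) = a *: mu x z.
Proof. by have := lie_linr mu x a z 0; rewrite /= lie0r !addr0. Qed.
Lemma lieNl x z : mu (- x) z = - mu x z.
Proof. by rewrite -scaleN1r lieZl scaleN1r. Qed.
Lemma lieNr x z : mu x (- z) = - mu x z.
Proof. by rewrite -scaleN1r lieZr scaleN1r. Qed.
Lemma lieC x y : mu x y = - mu y x.
Proof.
apply/eqP; rewrite -addr_eq0; apply/eqP.
have := lie_alt mu (x + y).
by rewrite lieDl !lieDr !lie_alt add0r addr0.
Qed.
Lemma lie_leibniz x y z : mu x (mu y z) = mu (mu x y) z + mu y (mu x z).
Proof.
have := lie_jacobi mu x y z.
rewrite (lieC z (mu x y)) (lieC z x) lieNr => /eqP.
by rewrite subr_eq0 subr_eq => /eqP.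
Qed.

Definition brspan X Y : subsp V :=
  span (fun z => exists x y, [/\ X x, Y y & z = mu x y]).
Definition derived : subsp V := brspan fullsp fullsp.
Definition metabelian : Prop := forall x, brspan derived derived x -> x = 0.
Definition generated_by (S : V -> Prop) : Prop :=
  forall X : subsp V, (forall x, S x -> X x) ->
    (forall x y, X x -> X y -> X (mu x y)) -> forall x, X x.

Definition derivation (f : V -> V) : Prop :=
  linear f /\ forall x y, f (mu x y) = mu (f x) y + mu x (f y).

Definition is_ideal X : Prop := forall x y, X y -> X (mu x y).

Lemma mem_brspan X Y x y : X x -> Y y -> brspan X Y (mu x y).
Proof. by move=> hx hy Z hZ; apply: hZ; exists x, y. Qed.
Lemma mem_derived x y : derived (mu x y).
Proof. exact: mem_brspan. Qed.

Fact second_derived_ideal : is_ideal (brspan derived derived).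
Proof.
move=> x y hy.
pose f := HB.pack_for {linear V -> V} (mu x) (GRing.isLinear.Build k V V _ (mu x) (lie_linr mu x)).
apply: (hy (preim f (brspan derived derived))) => _ [a [b [ha hb ->]]].
change (brspan derived derived (mu x (mu a b))); rewrite lie_leibniz.
by apply: subspD; apply: mem_brspan => //; exact: mem_derived.
Qed.

Section QuotientLie.
Variables (I : subsp V) (hI : is_ideal I).

Definition quot_br (c d : quotT I) : quotT I := quot_proj I (mu (repr c) (repr d)).

Lemma quot_brE x y : quot_br (quot_proj I x) (quot_proj I y) = quot_proj I (mu x y).
Proof.
apply/quotP; set x' := repr _; set y' := repr _.
have -> : mu x' y' - mu x y = mu x' (y' - y) + - mu y (x' - x).
  by rewrite !lieDr !lieNr (lieC y x') (lieC y x) opprD !opprK addrA subrK.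
apply: subspD; first by apply: hI; exact: quot_reprP.
by rewrite -scaleN1r; apply: subspZ; apply: hI; exact: quot_reprP.
Qed.

Fact quot_br_linl d : linear (quot_br^~ d).
Proof.
move=> a; elim/proj_ind=> x; elim/proj_ind=> y; elim/proj_ind: d => z.
by rewrite -linearP !quot_brE lieDl lieZl linearP.
Qed.
Fact quot_br_linr d : linear (quot_br d).
Proof.
move=> a; elim/proj_ind=> x; elim/proj_ind=> y; elim/proj_ind: d => z.
by rewrite -linearP !quot_brE lieDr lieZr linearP.
Qed.
Fact quot_br_alt c : quot_br c c = 0.
Proof.
by elim/proj_ind: c => x; rewrite quot_brE lie_alt linear0.
Qed.
Fact quot_br_jacobi (x y z : quotT I) :
  quot_br x (quot_br y z) + quot_br y (quot_br z x) + quot_br z (quot_br x y) = 0.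
Proof.
elim/proj_ind: x => x; elim/proj_ind: y => y; elim/proj_ind: z => z.
by rewrite !quot_brE -!linearD /= lie_jacobi linear0.
Qed.
Definition quot_lie : lieBracket (quotT I) :=
  LieBracket quot_br_linl quot_br_linr quot_br_alt quot_br_jacobi.
End QuotientLie.
End Lie.

Section FreeLie.
Variables (k : fieldType) (U : lmodType k).

Inductive lterm : Type :=
| LGen of U
| LZero
| LAdd of lterm & lterm
| LScale of k & lterm
| LBr of lterm & lterm.

Inductive lrel : lterm -> lterm -> Prop :=
| lrel_refl s : lrel s s
| lrel_sym s t : lrel s t -> lrel t s
| lrel_trans s t r : lrel s t -> lrel t r -> lrel s r
| lrel_add s s' t t' : lrel s s' -> lrel t t' -> lrel (LAdd s t) (LAdd s' t')
| lrel_scale a s s' : lrel s s' -> lrel (LScale a s) (LScale a s')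
| lrel_br s s' t t' : lrel s s' -> lrel t t' -> lrel (LBr s t) (LBr s' t')
| lrel_addA s t r : lrel (LAdd s (LAdd t r)) (LAdd (LAdd s t) r)
| lrel_addC s t : lrel (LAdd s t) (LAdd t s)
| lrel_add0 s : lrel (LAdd LZero s) s
| lrel_addN s : lrel (LAdd (LScale (-1) s) s) LZero
| lrel_scaleA a b s : lrel (LScale a (LScale b s)) (LScale (a * b) s)
| lrel_scale1 s : lrel (LScale 1 s) s
| lrel_scaleDr a s t : lrel (LScale a (LAdd s t)) (LAdd (LScale a s) (LScale a t))
| lrel_scaleDl a b s : lrel (LScale (a + b) s) (LAdd (LScale a s) (LScale b s))
| lrel_gen a u v : lrel (LGen (a *: u + v)) (LAdd (LScale a (LGen u)) (LGen v))
| lrel_brl a s t r :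
    lrel (LBr (LAdd (LScale a s) t) r) (LAdd (LScale a (LBr s r)) (LBr t r))
| lrel_brr a s t r :
    lrel (LBr r (LAdd (LScale a s) t)) (LAdd (LScale a (LBr r s)) (LBr r t))
| lrel_alt s : lrel (LBr s s) LZero
| lrel_jacobi s t r :
    lrel (LAdd (LAdd (LBr s (LBr t r)) (LBr t (LBr r s))) (LBr r (LBr s t))) LZero.

HB.instance Definition _ := gen_eqMixin lterm.
HB.instance Definition _ := gen_choiceMixin lterm.

Definition lrelb (s t : lterm) : bool := `[< lrel s t >].

Fact lrelb_equiv : equiv_class_of lrelb.
Proof.
split=> [s|s t|t s r].
- by apply/asboolP; exact: lrel_refl.
- by apply: asbool_equiv_eq; split; exact: lrel_sym.
- by move=> /asboolP h1 /asboolP h2; apply/asboolP; exact: lrel_trans h1 h2.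
Qed.
Canonical lrelb_equiv_rel := EquivRelPack lrelb_equiv.
Canonical lrelb_encModRel := defaultEncModRel lrelb.

Definition freeLie := {eq_quot lrelb}.
HB.instance Definition _ := EqQuotient.on freeLie.
HB.instance Definition _ := Choice.on freeLie.

Definition cls (s : lterm) : freeLie := \pi_freeLie s.

Lemma clsP s t : cls s = cls t <-> lrel s t.
Proof.
split=> [/eqmodP h|h]; first by apply/asboolP; exact: h.
by apply/eqmodP; apply/asboolP.
Qed.
Lemma cls_repr s : lrel (repr (cls s)) s.
Proof. by apply/clsP; rewrite /cls reprK. Qed.
Lemma cls_ind (P : freeLie -> Prop) : (forall s, P (cls s)) -> forall x, P x.
Proof. by move=> h x; rewrite -[x]reprK; exact: h. Qed.

Definition fl_add (x y : freeLie) := cls (LAdd (repr x) (repr y)).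
Definition fl_scale a (x : freeLie) := cls (LScale a (repr x)).
Definition fl_br (x y : freeLie) := cls (LBr (repr x) (repr y)).

Lemma fl_addE s t : fl_add (cls s) (cls t) = cls (LAdd s t).
Proof. by apply/clsP; apply: lrel_add; exact: cls_repr. Qed.
Lemma fl_scaleE a s : fl_scale a (cls s) = cls (LScale a s).
Proof. by apply/clsP; apply: lrel_scale; exact: cls_repr. Qed.
Lemma fl_brE s t : fl_br (cls s) (cls t) = cls (LBr s t).
Proof. by apply/clsP; apply: lrel_br; exact: cls_repr. Qed.

Fact fl_addA : associative fl_add.
Proof.
elim/cls_ind=> s; elim/cls_ind=> t; elim/cls_ind=> r.
by rewrite !fl_addE; apply/clsP; exact: lrel_addA.
Qed.
Fact fl_addC : commutative fl_add.
Proof.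
by elim/cls_ind=> s; elim/cls_ind=> t; rewrite !fl_addE; apply/clsP; exact: lrel_addC.
Qed.
Fact fl_add0 : left_id (cls LZero) fl_add.
Proof. by elim/cls_ind=> s; rewrite !fl_addE; apply/clsP; exact: lrel_add0. Qed.
Fact fl_addN : left_inverse (cls LZero) (fl_scale (-1)) fl_add.
Proof.
by elim/cls_ind=> s; rewrite fl_scaleE fl_addE; apply/clsP; exact: lrel_addN.
Qed.
HB.instance Definition _ :=
  GRing.isZmodule.Build freeLie fl_addA fl_addC fl_add0 fl_addN.

Lemma cls0 : cls LZero = 0. Proof. by []. Qed.
Lemma clsD s t : cls (LAdd s t) = cls s + cls t.
Proof. by rewrite -fl_addE. Qed.

Fact fl_scaleA a b x : fl_scale a (fl_scale b x) = fl_scale (a * b) x.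
Proof. by elim/cls_ind: x => s; rewrite !fl_scaleE; apply/clsP; exact: lrel_scaleA. Qed.
Fact fl_scale1 : left_id 1 fl_scale.
Proof. by elim/cls_ind=> s; rewrite !fl_scaleE; apply/clsP; exact: lrel_scale1. Qed.
Fact fl_scaleDr : right_distributive fl_scale +%R.
Proof.
move=> a; elim/cls_ind=> s; elim/cls_ind=> t.
by rewrite -clsD !fl_scaleE -clsD; apply/clsP; exact: lrel_scaleDr.
Qed.
Fact fl_scaleDl x : {morph fl_scale^~ x : a b / a + b}.
Proof.
move=> a b /=; elim/cls_ind: x => s.
by rewrite !fl_scaleE -clsD; apply/clsP; exact: lrel_scaleDl.
Qed.
HB.instance Definition _ := GRing.Zmodule_isLmodule.Build k freeLie
  fl_scaleA fl_scale1 fl_scaleDr fl_scaleDl.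

Lemma clsZ a s : cls (LScale a s) = a *: cls s.
Proof. by rewrite -fl_scaleE. Qed.

Fact fl_linl y : linear (fl_br^~ y).
Proof.
move=> a; elim/cls_ind=> s; elim/cls_ind=> t; elim/cls_ind: y => r.
by rewrite -clsZ -clsD /= !fl_brE -clsZ -clsD; apply/clsP; exact: lrel_brl.
Qed.
Fact fl_linr y : linear (fl_br y).
Proof.
move=> a; elim/cls_ind=> s; elim/cls_ind=> t; elim/cls_ind: y => r.
by rewrite -clsZ -clsD /= !fl_brE -clsZ -clsD; apply/clsP; exact: lrel_brr.
Qed.
Fact fl_alt x : fl_br x x = 0.
Proof. by elim/cls_ind: x => s; rewrite fl_brE; apply/clsP; exact: lrel_alt. Qed.
Fact fl_jacobi x y z :
  fl_br x (fl_br y z) + fl_br y (fl_br z x) + fl_br z (fl_br x y) = 0.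
Proof.
elim/cls_ind: x => x; elim/cls_ind: y => y; elim/cls_ind: z => z.
by rewrite !fl_brE -!clsD; apply/clsP; exact: lrel_jacobi.
Qed.
Definition freeLie_br : lieBracket freeLie :=
  LieBracket fl_linl fl_linr fl_alt fl_jacobi.

Lemma freeLie_brE s t : freeLie_br (cls s) (cls t) = cls (LBr s t).
Proof. exact: fl_brE. Qed.

Definition freeLie_gen (u : U) : freeLie := cls (LGen u).
Fact freeLie_gen_linear : linear freeLie_gen.
Proof. by move=> a u v; rewrite -clsZ -clsD; apply/clsP; exact: lrel_gen. Qed.

Section Universal.
Variables (V : lmodType k) (mu : lieBracket V) (f : U -> V).

Fixpoint lterm_lift (s : lterm) : V :=
  match s with
  | LGen u => f u
  | LZero => 0
  | LAdd s t => lterm_lift s + lterm_lift t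
  | LScale a s => a *: lterm_lift s
  | LBr s t => mu (lterm_lift s) (lterm_lift t)
  end.
Definition freeLie_lift (x : freeLie) : V := lterm_lift (repr x).

Hypothesis flin : linear f.

Lemma lterm_lift_rel s t : lrel s t -> lterm_lift s = lterm_lift t.
Proof.
elim=> {s t} //=; try by move=> *; congruence.
- by move=> *; rewrite addrA.
- by move=> *; rewrite addrC.
- by move=> *; rewrite add0r.
- by move=> *; rewrite scaleN1r addNr.
- by move=> *; rewrite scalerA.
- by move=> *; rewrite scale1r.
- by move=> *; rewrite scalerDr.
- by move=> *; rewrite scalerDl.
- by move=> *; rewrite lieDl lieZl.
- by move=> *; rewrite lieDr lieZr.
- by move=> *; rewrite lie_alt.
- by move=> *; rewrite lie_jacobi.
Qed.

Lemma freeLie_liftE s : freeLie_lift (cls s) = lterm_lift s.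
Proof. by apply: lterm_lift_rel; exact: cls_repr. Qed.

Lemma freeLie_universal :
  [/\ linear freeLie_lift,
      forall x y, freeLie_lift (freeLie_br x y) = mu (freeLie_lift x) (freeLie_lift y)
    & forall u, freeLie_lift (freeLie_gen u) = f u].
Proof.
split.
- move=> a; elim/cls_ind=> s; elim/cls_ind=> t.
  by rewrite -clsZ -clsD !freeLie_liftE.
- by elim/cls_ind=> s; elim/cls_ind=> t; rewrite freeLie_brE !freeLie_liftE.
- by move=> u; rewrite freeLie_liftE.
Qed.
End Universal.
End FreeLie.

Section DerivationLemmas.
Variables (k : fieldType) (V : lmodType k) (mu : lieBracket V) (f : V -> V).
Hypothesis hf : derivation mu f.

Lemma lin_span (W : lmodType k) (h : V -> W) (S : V -> Prop) (Y : subsp W) :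
  linear h -> (forall x, S x -> Y (h x)) -> forall x, span S x -> Y (h x).
Proof.
move=> hlin hS x hx.
pose h' := HB.pack_for {linear V -> W} h (GRing.isLinear.Build k V W _ h hlin).
exact: (hx (preim h' Y)).
Qed.

Lemma derivation_brspan (X Y : subsp V) :
  (forall x, X x -> X (f x)) -> (forall y, Y y -> Y (f y)) ->
  forall x, brspan mu X Y x -> brspan mu X Y (f x).
Proof.
move=> hX hY; apply: (lin_span hf.1) => _ [x [y [hx hy ->]]].
rewrite hf.2; apply: subspD; apply: mem_brspan => //; [exact: hX|exact: hY].
Qed.

Lemma derivation_derived x : derived mu x -> derived mu (f x).
Proof. exact: derivation_brspan. Qed.
End DerivationLemmas.

Section FreeMetabelian.
Variables (k : fieldType) (U : lmodType k).

Local Notation lie := (freeLie_br U).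

Definition second_derived : subsp (freeLie U) := brspan lie (derived lie) (derived lie).

(* M(U) = Lie(U) / Lie(U)''; below, [metaB] is B(U) = M(U)'. *)
Definition metaLie := quotT second_derived.
HB.instance Definition _ := GRing.Lmodule.on metaLie.

Definition metaLie_br : lieBracket metaLie := quot_lie (second_derived_ideal (mu := lie)).

Lemma metaLie_brE x y :
  metaLie_br (quot_proj second_derived x) (quot_proj second_derived y) =
  quot_proj second_derived (lie x y).
Proof. exact: (quot_brE (second_derived_ideal (mu := lie))). Qed.

Definition metaLie_gen (u : U) : metaLie := quot_proj second_derived (freeLie_gen u).

Fact metaLie_gen_linear : linear metaLie_gen.
Proof. by move=> a u v; rewrite /metaLie_gen freeLie_gen_linear linearP. Qed.

(* For metabelian [mu] and linear [f] this does not depend on the representative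
   and is the unique Lie morphism extending [f]. *)
Definition metaLie_lift (V : lmodType k) (mu : lieBracket V) (f : U -> V)
  (m : metaLie) : V := freeLie_lift mu f (repr m).

Inductive monomial : nat -> metaLie -> Prop :=
| monomial_gen u : monomial 1 (metaLie_gen u)
| monomial_br i j x y : monomial i x -> monomial j y ->
    monomial (i + j) (metaLie_br x y).

Definition metaLie_deg (i : nat) : subsp metaLie := span (monomial i).

Definition metaB := subT (derived metaLie_br).
HB.instance Definition _ := GRing.Lmodule.on metaB.

(* Internal degree [r] is Lie degree [r + 2]. *)
Definition metaB_deg (r : nat) : subsp metaB := preim val (metaLie_deg r.+2).

Definition metaB_act (u : U) (b : metaB) : metaB :=
  inSub (mem_derived (mu := metaLie_br) (metaLie_gen u) (val b)).

Section InducedDerivation.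
Variable a : U -> U.

Fixpoint lterm_der (s : lterm U) : freeLie U :=
  match s with
  | LGen u => freeLie_gen (a u)
  | LZero => 0
  | LAdd s t => lterm_der s + lterm_der t
  | LScale c s => c *: lterm_der s
  | LBr s t => lie (lterm_der s) (cls t) + lie (cls s) (lterm_der t)
  end.
Definition freeLie_der (x : freeLie U) : freeLie U := lterm_der (repr x).
Definition metaLie_der (m : metaLie) : metaLie :=
  quot_proj second_derived (freeLie_der (repr m)).

Hypothesis alin : linear a.

Lemma lterm_der_rel s t : lrel s t -> lterm_der s = lterm_der t.
Proof.
elim=> {s t} //=; try by move=> *; congruence.
- by move=> s s' t t' /clsP -> -> /clsP -> ->.
- by move=> *; rewrite addrA.
- by move=> *; rewrite addrC.
- by move=> *; rewrite add0r.
- by move=> *; rewrite scaleN1r addNr.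
- by move=> *; rewrite scalerA.
- by move=> *; rewrite scale1r.
- by move=> *; rewrite scalerDr.
- by move=> *; rewrite scalerDl.
- by move=> *; rewrite alin freeLie_gen_linear.
- by move=> c s t r; rewrite !clsD !clsZ !lieDl !lieZl scalerDr addrACA.
- by move=> c s t r; rewrite !clsD !clsZ !lieDr !lieZr scalerDr addrACA.
- by move=> s; rewrite (lieC lie (cls s)) subrr.
- move=> s t r; rewrite -!freeLie_brE !lieDr !addrA.
  set S := cls s; set T := cls t; set R := cls r.
  set s' := lterm_der s; set t' := lterm_der t; set r' := lterm_der r.
  have j1 := lie_jacobi lie s' T R; have j2 := lie_jacobi lie S t' R.
  have j3 := lie_jacobi lie S T r'.
  rewrite -[RHS]addr0 -[RHS]addr0 -{1}j1 -{1}j2 -{1}j3 !addrA.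
  by rewrite [LHS](AC 9 (1*6*8*2*4*9*3*5*7)%AC).
Qed.

Lemma freeLie_derE s : freeLie_der (cls s) = lterm_der s.
Proof. by apply: lterm_der_rel; exact: cls_repr. Qed.

Lemma freeLie_der_derivation : derivation lie freeLie_der.
Proof.
split.
- move=> c; elim/cls_ind=> s; elim/cls_ind=> t.
  by rewrite -clsZ -clsD !freeLie_derE.
- elim/cls_ind=> s; elim/cls_ind=> t.
  by rewrite freeLie_brE !freeLie_derE.
Qed.

Lemma metaLie_derE x :
  metaLie_der (quot_proj second_derived x) = quot_proj second_derived (freeLie_der x).
Proof.
apply/projP.
have [hl hd] := freeLie_der_derivation.
have -> : forall y, freeLie_der y - freeLie_der x = freeLie_der (y - x).
  by move=> y; rewrite -[y - x]addrC -scaleN1r hl scaleN1r addrC.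
apply: (derivation_brspan freeLie_der_derivation) (quot_reprP _ _);
  exact: derivation_derived freeLie_der_derivation.
Qed.

Lemma metaLie_der_derivation : derivation metaLie_br metaLie_der.
Proof.
have [hl hd] := freeLie_der_derivation.
split.
- move=> c; elim/proj_ind=> x; elim/proj_ind=> y.
  by rewrite -linearP !metaLie_derE hl linearP.
- elim/proj_ind=> x; elim/proj_ind=> y.
  by rewrite metaLie_brE !metaLie_derE hd linearD !metaLie_brE.
Qed.

Lemma metaLie_der_gen u : metaLie_der (metaLie_gen u) = metaLie_gen (a u).
Proof. by rewrite metaLie_derE freeLie_derE. Qed.

Lemma metaLie_der_deg i m : metaLie_deg i m -> metaLie_deg i (metaLie_der m).
Proof.
apply: (lin_span metaLie_der_derivation.1) => {}m.
have hmon j x : monomial j x -> metaLie_deg j x by move=> h X; apply.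
elim=> {i m} [u|i j x y mx hx my hy].
  by rewrite metaLie_der_gen; apply: hmon; constructor.
rewrite metaLie_der_derivation.2; apply: subspD.
- apply: (lin_span (lie_linl metaLie_br y)) hx => z mz.
  by apply: hmon; constructor.
- apply: (lin_span (lie_linr metaLie_br x)) hy => z mz.
  by apply: hmon; constructor.
Qed.

Definition metaB_der (b : metaB) : metaB :=
  inSub (derivation_derived metaLie_der_derivation (subTP b)).

End InducedDerivation.

End FreeMetabelian.

Section SymAction.
Variables (k : fieldType) (U : vectType k).

(* Sym(U) as the polynomial ring on the coordinates of a basis of [U] *)
Definition SymU := {mpoly k[\dim {:U}]}.

(* The action of Sym(U) on [V] in which [u : U] acts by [rho u], for [rho] linear in
   [u] with commuting values.  For [u . b = [u, b]] on B(U) the values commute by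
   the Jacobi and metabelian identities. *)
Definition sym_act (V : lmodType k) (rho : U -> V -> V) (P : SymU) (v : V) : V :=
  \sum_(m <- msupp P) P@_m *:
    foldr (fun i w => iter (m i) (rho (vbasis {:U})`_i) w) v (enum 'I_(\dim {:U})).

Lemma sym_act_mnm1 (V : lmodType k) (rho : U -> V -> V) i v :
  sym_act rho 'X_i v = rho (vbasis {:U})`_i v.
Proof.
rewrite /sym_act msuppX big_seq1 mcoeffX eqxx scale1r.
have hs : forall s, i \notin s ->
    foldr (fun j w => iter (U_(i)%MM j) (rho (vbasis {:U})`_j) w) v s = v.
  elim=> //= j s IH; rewrite inE negb_or => /andP[ij /IH ->].
  by rewrite mnm1E (negbTE ij).
have [s1 [s2 [-> h1 h2]]] : exists s1 s2,
    [/\ enum 'I_(\dim {:U}) = s1 ++ i :: s2, i \notin s1 & i \notin s2].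
  have := enum_uniq 'I_(\dim {:U}); have := mem_enum 'I_(\dim {:U}) i.
  case/splitPr=> s1 s2; rewrite cat_uniq /= negb_or => /and4P[_ /andP[h1 _] h2 _].
  by exists s1, s2.
have hc : forall w, foldr (fun j w => iter (U_(i)%MM j) (rho (vbasis {:U})`_j) w) w s1 = w.
  move=> w; elim: s1 h1 => //= j s IH; rewrite inE negb_or => /andP[ij /IH ->].
  by rewrite mnm1E (negbTE ij).
by rewrite foldr_cat /= hs // mnm1E eqxx /= hc.
Qed.

Lemma sym_act_morph (V W : lmodType k) (X : subsp V) (f : V -> W)
    (rho : U -> V -> V) (sigma : U -> W -> W) :
  linear f -> (forall u v, X v -> X (rho u v)) ->
  (forall u v, X v -> f (rho u v) = sigma u (f v)) ->
  forall P v, X v -> f (sym_act rho P v) = sym_act sigma P (f v).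
Proof.
move=> flin hX hf P v hv.
pose f' := HB.pack_for {linear V -> W} f (GRing.isLinear.Build k V W _ f flin).
rewrite -[f _]/(f' _) /sym_act linear_sum; apply: eq_bigr => m _.
rewrite linearZ /=; congr (_ *: _).
suff [] : X (foldr (fun i w => iter (m i) (rho (vbasis {:U})`_i) w) v (enum 'I_(\dim {:U})))
    /\ f (foldr (fun i w => iter (m i) (rho (vbasis {:U})`_i) w) v (enum 'I_(\dim {:U})))
    = foldr (fun i w => iter (m i) (sigma (vbasis {:U})`_i) w) (f v) (enum 'I_(\dim {:U})).
  by [].
elim: (enum _) => //= i s [IH1 IH2].
elim: (m i) => //= n [h1 h2]; split; first exact: hX.
by rewrite hf // h2.
Qed.
End SymAction.

Section QuotPoints.
Variables (k : fieldType) (U : vectType k).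

(* A k-point of Q_h: an isomorphism class of homogeneous quotients of B(U) is
   the same as its kernel. *)
Record quot_point (h : nat -> nat) := QuotPoint {
  qker : subsp (metaB U);
  qker_stable : forall (P : SymU U) b, qker b -> qker (sym_act (@metaB_act k U) P b);
  qker_homog : forall b, qker b ->
    span (fun c => qker c /\ exists r, metaB_deg U r c) b;
  qker_rank : forall r, has_dim (subT (image (quot_proj qker) (metaB_deg U r))) (h r)
}.

Variables (h : nat -> nat) (q : quot_point h).

Definition qN := subT (qker q).
HB.instance Definition _ := GRing.Lmodule.on qN.
Definition qC := quotT (qker q).
HB.instance Definition _ := GRing.Lmodule.on qC.

Definition qmap (b : metaB U) : qC := quot_proj (qker q) b.
Fact qmap_linear : linear qmap. Proof. exact: linearP. Qed.
HB.instance Definition _ := GRing.isLinear.Build k (metaB U) qC _ qmap qmap_linear.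

Definition qN_act (P : SymU U) (n : qN) : qN :=
  inSub (qker_stable P (subTP n)).
(* well defined by [qC_uactE] *)
Definition qC_uact (u : U) (c : qC) : qC := qmap (metaB_act u (repr c)).
Definition qC_act : SymU U -> qC -> qC := sym_act qC_uact.

Lemma metaB_act_linl (b : metaB U) : linear (fun u => metaB_act u b).
Proof.
by move=> a u v; apply: val_inj; rewrite /= metaLie_gen_linear lieDl lieZl.
Qed.
Lemma metaB_act_linr u : linear (@metaB_act k U u).
Proof. by move=> a x y; apply: val_inj; rewrite /= lieDr lieZr. Qed.

Lemma qker_act u b : qker q b -> qker q (metaB_act u b).
Proof.
move=> hb; rewrite (coord_vbasis (memvf u)).
pose f := HB.pack_for {linear U -> metaB U} (fun u => metaB_act u b)
  (GRing.isLinear.Build k U (metaB U) _ (fun u => metaB_act u b) (metaB_act_linl b)).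
rewrite -[metaB_act _ b]/(f _) linear_sum.
apply: (big_ind (qker q)) => [||i _]; [exact: subsp0|exact: subspD|].
rewrite linearZ /=; apply: subspZ.
by rewrite -sym_act_mnm1; exact: qker_stable.
Qed.

Lemma qC_uactE u b : qC_uact u (qmap b) = qmap (metaB_act u b).
Proof.
apply/projP; rewrite -[X in _ - X]scale1r -scaleNr addrC -metaB_act_linr.
apply: qker_act; rewrite scaleN1r addrC; exact: quot_reprP.
Qed.

Definition homR0_prop (f : qN -> qC) : Prop :=
  [/\ linear f,
      forall P n, f (qN_act P n) = qC_act P (f n)
    & forall r n, metaB_deg U r (val n) -> image qmap (metaB_deg U r) (f n)].

Lemma qC_uact_linear u : linear (qC_uact u).
Proof.
move=> a; elim/proj_ind=> x; elim/proj_ind=> y.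
rewrite -!/(qmap _) -linearP !qC_uactE metaB_act_linr.
by rewrite -linearP.
Qed.

Lemma qC_act_linear P : linear (qC_act P).
Proof.
have hl i e (a : k) (x y : qC) :
    iter i (qC_uact e) (a *: x + y) = a *: iter i (qC_uact e) x + iter i (qC_uact e) y.
  by elim: i => //= i ->; rewrite qC_uact_linear.
move=> a x y; rewrite /qC_act /sym_act scaler_sumr -big_split.
apply: eq_bigr => m _ /=; rewrite scalerA mulrC -scalerA -scalerDr; congr (_ *: _).
by elim: (enum _) => //= i s ->; rewrite hl.
Qed.

Fact homR0_0 : homR0_prop (fun=> 0).
Proof.
split=> [a x y|P n|r n _]; first by rewrite scaler0 addr0.
  by have := qC_act_linear P (-1) 0 0; rewrite !scaleN1r oppr0 addr0 addNr.
exact: subsp0.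
Qed.
Fact homR0_D f g : homR0_prop f -> homR0_prop g -> homR0_prop (f + g).
Proof.
move=> [f1 f2 f3] [g1 g2 g3]; split=> [a x y|P n|r n hn]; rewrite !fctE.
- by rewrite f1 g1 scalerDr addrACA.
- by rewrite f2 g2 -[f n]scale1r qC_act_linear !scale1r.
- by apply: subspD; [exact: f3|exact: g3].
Qed.
Fact homR0_Z c f : homR0_prop f -> homR0_prop (c *: f).
Proof.
move=> [f1 f2 f3]; split=> [a x y|P n|r n hn]; rewrite !scalrfctE.
- by rewrite f1 scalerDr !scalerA mulrC.
- have h0 : qC_act P 0 = 0.
    by have := qC_act_linear P (-1) 0 0; rewrite !scaleN1r oppr0 addr0 addNr.
  by rewrite f2 -[c *: f n]addr0 qC_act_linear h0 addr0.
- by apply: subspZ; exact: f3.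
Qed.

Definition homR0 : subsp (qN -> qC) := Subsp homR0_0 homR0_D homR0_Z.

Section Orbit.
Variable a : 'End(U).

Let alin : linear a := linearP a.

Definition dorb_fun (n : qN) : qC := qmap (metaB_der alin (val n)).

Lemma metaB_der_act u b :
  metaB_der alin (metaB_act u b) =
  metaB_act (a u) b + metaB_act u (metaB_der alin b).
Proof.
apply: val_inj => /=; rewrite (metaLie_der_derivation alin).2.
by rewrite metaLie_der_gen.
Qed.

Lemma metaB_der_linear : linear (metaB_der alin).
Proof.
by move=> c x y; apply: val_inj; rewrite /= (metaLie_der_derivation alin).1.
Qed.

Lemma qmap_ker b : qker q b -> qmap b = 0.
Proof. by move=> hb; rewrite -(linear0 qmap); apply/projP; rewrite subr0. Qed.

Fact dorb_homR0 : homR0 dorb_fun.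
Proof.
split.
- by move=> c x y; rewrite /dorb_fun !linearP metaB_der_linear linearP.
- move=> P n.
  apply: (@sym_act_morph _ _ _ _ (qker q) (fun b => qmap (metaB_der alin b)) _ qC_uact _ _ _ P (val n) (subTP n)).
  + by move=> c x y; rewrite metaB_der_linear linearP.
  + by move=> u v; exact: qker_act.
  + move=> u v hv; rewrite metaB_der_act linearD /= qC_uactE.
    by rewrite (qmap_ker (qker_act _ hv)) add0r.
- by move=> r n hn; exists (metaB_der alin (val n)) => //; exact: metaLie_der_deg.
Qed.
End Orbit.

Lemma metaLie_der_linear (m : metaLie U) :
  linear (fun a : 'End(U) => metaLie_der a m).
Proof.
move=> c a b; elim/proj_ind: m => x.
rewrite !metaLie_derE; try exact: linearP.
transitivity (quot_proj (second_derived U) (c *: freeLie_der a x + freeLie_der b x)); last exact: linearP.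
congr (quot_proj _ _); elim/cls_ind: x => s.
rewrite !freeLie_derE; try exact: linearP.
elim: s => /= [u||s -> t ->|d s ->|s -> t ->].
- by rewrite add_lfunE scale_lfunE freeLie_gen_linear.
- by rewrite scaler0 addr0.
- by rewrite scalerDr addrACA.
- by rewrite scalerDr !scalerA mulrC.
- by rewrite lieDl lieDr lieZl lieZr scalerDr addrACA.
Qed.

Definition dorb (a : 'End(U)) : subT homR0 := inSub (dorb_homR0 a).

Fact dorb_linear : linear dorb.
Proof.
move=> c a b; apply: val_inj; apply/funext => n /=.
transitivity (qmap (c *: metaB_der (linearP a) (val n) + metaB_der (linearP b) (val n)));
  last exact: linearP.
congr (qmap _).
by apply: val_inj => /=; exact: metaLie_der_linear.
Qed.
HB.instance Definition _ :=
  GRing.isLinear.Build k 'End(U) (subT homR0) _ dorb dorb_linear.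
End QuotPoints.

(* A complex [T^{-1} -> T^0]; its terms in the other degrees are zero, so that
   H^{-1} is the kernel and H^0 the cokernel of its differential. *)
Record two_term (k : fieldType) := TwoTerm {
  tt_m1 : lmodType k;
  tt_0 : lmodType k;
  tt_d : {linear tt_m1 -> tt_0}
}.
Definition Hm1 (k : fieldType) (T : two_term k) : lmodType k := subT (ker (tt_d T)).
Definition H0 (k : fieldType) (T : two_term k) : lmodType k := coker (tt_d T).
Definition H0_class (k : fieldType) (T : two_term k) (x : tt_0 T) : H0 T :=
  quot_proj (image (tt_d T) fullsp) x.

Definition tangent_complex (k : fieldType) (U : vectType k) h (q : quot_point U h) :
  two_term k := TwoTerm (@dorb k U h q : {linear _ -> _}).

Section Graded.
Variables (k : fieldType) (g : vectType k) (mu : lieBracket g) (L : nat -> {vspace g}).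

Definition positive_grading : Prop :=
  [/\ L 0%N = 0%VS,
      exists n, [/\ forall i, (n <= i)%N -> L i = 0%VS,
                    directv (\sum_(i < n) L i)
                  & (\sum_(i < n) L i)%VS = fullv]
    & forall i j x y, x \in L i -> y \in L j -> mu x y \in L (i + j)%N].

Definition cochain1_prop (f : g -> g) : Prop :=
  linear f /\ forall i x, x \in L i -> f x \in L i.
Fact cochain1_0 : cochain1_prop 0.
Proof.
split=> [a x y|i x _]; last exact: mem0v.
by change (0 = a *: (0 : g) + 0); rewrite scaler0 addr0.
Qed.
Fact cochain1_D f f' : cochain1_prop f -> cochain1_prop f' -> cochain1_prop (f + f').
Proof.
move=> [f1 f2] [f1' f2']; split=> [a x y|i x hx]; rewrite !fctE.
  by rewrite f1 f1' scalerDr addrACA.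
by apply: memvD; [exact: f2|exact: f2'].
Qed.
Fact cochain1_Z c f : cochain1_prop f -> cochain1_prop (c *: f).
Proof.
move=> [f1 f2]; split=> [a x y|i x hx]; rewrite !scalrfctE.
  by rewrite f1 scalerDr !scalerA mulrC.
by apply: memvZ; exact: f2.
Qed.
Definition C1_0 : subsp (g -> g) := Subsp cochain1_0 cochain1_D cochain1_Z.

(* Hom(Lambda^2 V, g)_0, for [V] graded by [DV], as alternating bilinear maps *)
Section Alt2.
Variables (V : lmodType k) (DV : nat -> V -> Prop).
Definition alt2_prop (phi : V -> V -> g) : Prop :=
  [/\ forall y, linear (phi^~ y), forall x, linear (phi x),
      forall x, phi x x = 0
    & forall i j x y, DV i x -> DV j y -> phi x y \in L (i + j)%N].
Fact alt2_0 : alt2_prop 0.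
Proof.
split=> [y a x z|y a x z|x|i j x y _ _] //; last exact: mem0v.
- by change (0 = a *: (0 : g) + 0); rewrite scaler0 addr0.
- by change (0 = a *: (0 : g) + 0); rewrite scaler0 addr0.
Qed.
Fact alt2_D f f' : alt2_prop f -> alt2_prop f' -> alt2_prop (f + f').
Proof.
move=> [a1 a2 a3 a4] [b1 b2 b3 b4]; split.
- by move=> y a x z; have := a1 y a x z; have := b1 y a x z; rewrite /= !fctE => -> ->;
  rewrite scalerDr addrACA.
- by move=> y a x z; have := a2 y a x z; have := b2 y a x z; rewrite /= !fctE => -> ->;
  rewrite scalerDr addrACA.
- by move=> x; rewrite !fctE a3 b3 addr0.
- by move=> i j x y hx hy; rewrite !fctE; apply: memvD; [exact: a4|exact: b4].
Qed.
Fact alt2_Z c f : alt2_prop f -> alt2_prop (c *: f).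
Proof.
move=> [a1 a2 a3 a4]; split.
- by move=> y a x z; have := a1 y a x z; rewrite /= !scalrfctE => ->;
  rewrite scalerDr !scalerA mulrC.
- by move=> y a x z; have := a2 y a x z; rewrite /= !scalrfctE => ->;
  rewrite scalerDr !scalerA mulrC.
- by move=> x; rewrite !scalrfctE a3 scaler0.
- by move=> i j x y hx hy; rewrite !scalrfctE; apply: memvZ; exact: a4.
Qed.
Definition alt2 : subsp (V -> V -> g) := Subsp alt2_0 alt2_D alt2_Z.
End Alt2.

Definition C2_0 : subsp (g -> g -> g) := alt2 (fun i x => x \in L i).

Definition hom_L2d : subsp (subT (derived mu) -> subT (derived mu) -> g) :=
  alt2 (fun i x => val x \in L i).

Definition ce1 (f : g -> g) (x y : g) : g := mu x (f y) - mu y (f x) - f (mu x y).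
Definition ce2 (phi : g -> g -> g) (x y z : g) : g :=
  mu x (phi y z) - mu y (phi x z) + mu z (phi x y)
  - phi (mu x y) z + phi (mu x z) y - phi (mu y z) x.

Fact ce1_linear : linear ce1.
Proof.
move=> a f f'; apply/funext => x; apply/funext => y.
rewrite /ce1 !fctE !lieDr !lieZr scalerBr scalerBr.
by rewrite !opprD !addrA [LHS](AC 6 (1*3*5*2*4*6)%AC).
Qed.
HB.instance Definition _ :=
  GRing.isLinear.Build k (g -> g) (g -> g -> g) _ ce1 ce1_linear.

Fact ce2_linear : linear ce2.
Proof.
move=> a f f'; apply/funext => x; apply/funext => y; apply/funext => z.
rewrite /ce2 !fctE !lieDr !lieZr !(scalerBr, scalerDr).
by rewrite !opprD !addrA [LHS](AC 12 (1*3*5*7*9*11*2*4*6*8*10*12)%AC).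
Qed.
HB.instance Definition _ :=
  GRing.isLinear.Build k (g -> g -> g) (g -> g -> g -> g) _ ce2 ce2_linear.

Fact cocycle2_0 : C2_0 0 /\ ker ce2 0.
Proof. by split; exact: subsp0. Qed.
Fact cocycle2_D phi psi : C2_0 phi /\ ker ce2 phi -> C2_0 psi /\ ker ce2 psi ->
  C2_0 (phi + psi) /\ ker ce2 (phi + psi).
Proof. by move=> [p1 p2] [q1 q2]; split; apply: subspD. Qed.
Fact cocycle2_Z c phi : C2_0 phi /\ ker ce2 phi ->
  C2_0 (c *: phi) /\ ker ce2 (c *: phi).
Proof. by move=> [p1 p2]; split; apply: subspZ. Qed.

Definition Z2_0 : subsp (g -> g -> g) :=
  @Subsp k _ (fun phi => C2_0 phi /\ ker ce2 phi) cocycle2_0 cocycle2_D cocycle2_Z.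
Definition B2_0 : subsp (g -> g -> g) := image ce1 C1_0.
Definition B2_0_in_Z2_0 : subsp (subT Z2_0) := preim val B2_0.
Definition H2_0 : lmodType k := quotT B2_0_in_Z2_0.
Definition H2_0_class (phi : subT Z2_0) : H2_0 := quot_proj B2_0_in_Z2_0 phi.

Definition vanishes_on_L2d (phi : g -> g -> g) : Prop :=
  forall x y, derived mu x -> derived mu y -> phi x y = 0.

Definition der0_prop (f : g -> g) : Prop := C1_0 f /\ derivation mu f.
Fact der_0 : der0_prop 0.
Proof.
split; first exact: subsp0.
split=> [a x y|x y]; first exact: cochain1_0.1.
by change (0 = mu 0 y + mu x 0); rewrite lie0l lie0r addr0.
Qed.
Fact der_D f f' : der0_prop f -> der0_prop f' -> der0_prop (f + f').
Proof.
move=> [f0 [f1 f2]] [f0' [f1' f2']].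
have h := subspD f0 f0'; split=> //; split; first exact: h.1.
by move=> x y; rewrite !fctE f2 f2' lieDl lieDr addrACA.
Qed.
Fact der_Z c f : der0_prop f -> der0_prop (c *: f).
Proof.
move=> [f0 [f1 f2]]; have h := subspZ c f0; split=> //; split; first exact: h.1.
by move=> x y; rewrite !scalrfctE f2 scalerDr lieZl lieZr.
Qed.
Definition Der_0 : subsp (g -> g) := Subsp der_0 der_D der_Z.

(* A pair [(x0, x1)] stands for [x0 + eps x1] in g[eps]/(eps^2); [def_br phi] is
   the k[eps]-bilinear extension of [mu + eps phi]. *)
Definition def_br (phi : g -> g -> g) (x y : g * g) : g * g :=
  (mu x.1 y.1, mu x.1 y.2 + mu x.2 y.1 + phi x.1 y.1).

Definition metabelian_deformation (phi : g -> g -> g) : Prop :=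
  [/\ C2_0 phi,
      forall x y z, def_br phi x (def_br phi y z) + def_br phi y (def_br phi z x)
                    + def_br phi z (def_br phi x y) = 0
    & forall x y z t, def_br phi (def_br phi x y) (def_br phi z t) = 0].

Definition equiv_deformation (phi phi' : g -> g -> g) : Prop :=
  exists2 f : g -> g, C1_0 f &
    let F (x : g * g) := (x.1, x.2 + f x.1) in
    forall x y, F (def_br phi x y) = def_br phi' (F x) (F y).

Local Notation U := (subvs_of (L 1%N)).

(* The universal map M(L_1) -> g *)
Definition univ_map : metaLie U -> g := metaLie_lift mu (vsval : U -> g).

Definition corresponds h (q : quot_point U h) : Prop :=
  forall m, univ_map m = 0 <-> exists2 b : metaB U, qker q b & m = val b.

(* [P = univ_map + eps theta] is the morphism from M(U) to the deformation
   [mu + eps phi] which is the identity on [U].  Its k[eps]-linear extension to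
   M(U)[eps] has a kernel which is a deformation of [N]; [psi] is the tangent
   vector to this deformation: [n + eps b] is in the kernel iff [psi n] is the
   class of [b]. *)
Definition relation_variation h (q : quot_point U h) (phi : g -> g -> g)
    (psi : qN q -> qC q) : Prop :=
  exists2 theta : metaLie U -> g, linear theta &
    let P (m : metaLie U) := (univ_map m, theta m) in
    [/\ forall u, P (metaLie_gen u) = (vsval u, 0),
        forall a b, P (metaLie_br U a b) = def_br phi (P a) (P b)
      & forall (n : qN q) (b : metaB U),
          psi n = qmap q b <-> theta (val (val n)) + univ_map (val b) = 0].

End Graded.

(* Main.v *)
(* A degree-zero cocycle phi vanishing on the exterior square of g' makes
   mu + eps phi a metabelian Lie bracket on g[eps], so by freeness the identity of
   L_1 extends to a morphism univ + eps theta from M(L_1).  On the relation module N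
   the map theta is R-linear with values in g' = C, and -theta is the tangent vector
   psi : N -> C.  If phi = d f then theta = univ o a~ - f o univ, with a the
   restriction of f to L_1, so that psi lies in the orbit direction; conversely, if
   theta agrees on N with univ o a~ for some a in gl(L_1), then theta - univ o a~
   descends to a 1-cochain bounding phi up to sign.  Every psi arises: a graded
   section s of univ which is the identity on L_1 splits M(L_1) as s(g) + N, and the
   extension theta of -psi by zero gives the cocycle phi(x, y) = theta [s x, s y].
   Likewise, a in gl(L_1) is tangent to the stabilizer iff univ o a~ kills N, i.e.
   iff a extends to a derivation of g. *)

Require Import Defs.
From HB Require Import structures.
From mathcomp Require Import all_boot all_order all_algebra.
From mathcomp Require Import boolp functions mpoly ring.

Set Implicit Arguments.
Unset Strict Implicit.
Unset Printing Implicit Defensive.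

Import GRing.Theory.
Local Open Scope ring_scope.

(** * Linear maps and free metabelian Lie algebras *)

Section LinearFacts.
Variables (k : fieldType) (V W : lmodType k) (f : V -> W) (hf : linear f).

Definition lin_pack : {linear V -> W} :=
  HB.pack_for {linear V -> W} f (GRing.isLinear.Build k V W _ f hf).

Lemma lin0 : f 0 = 0. Proof. exact: (linear0 lin_pack). Qed.
Lemma linD x y : f (x + y) = f x + f y. Proof. exact: (linearD lin_pack). Qed.
Lemma linN x : f (- x) = - f x. Proof. exact: (linearN lin_pack). Qed.
Lemma linB x y : f (x - y) = f x - f y. Proof. exact: (linearB lin_pack). Qed.
Lemma linZ a x : f (a *: x) = a *: f x. Proof. exact: (linearZ_LR lin_pack). Qed.
Lemma lin_sum (I : Type) (r : seq I) (P : pred I) (F : I -> V) :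
  f (\sum_(i <- r | P i) F i) = \sum_(i <- r | P i) f (F i).
Proof. exact: (linear_sum lin_pack). Qed.
End LinearFacts.

Section SubspFacts.
Variables (k : fieldType) (V : lmodType k).
Implicit Type X : subsp V.

Lemma subspN X x : X x -> X (- x).
Proof. by move=> hx; rewrite -scaleN1r; apply: subspZ. Qed.

Lemma subspB X x y : X x -> X y -> X (x - y).
Proof. by move=> hx hy; apply: subspD => //; apply: subspN. Qed.

Lemma subsp_sum X (I : Type) (r : seq I) (P : pred I) (F : I -> V) :
  (forall i, P i -> X (F i)) -> X (\sum_(i <- r | P i) F i).
Proof.
by move=> h; apply: (big_ind X) => //; [exact: subsp0|move=> *; exact: subspD].
Qed.

Lemma mem_span (S : V -> Prop) x : S x -> Defs.span S x.
Proof. by move=> hx X; apply. Qed.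

Lemma inSubK X (x : V) (h : X x) : val (inSub h) = x.
Proof. by []. Qed.
Lemma val_linear X : linear (val : subT X -> V).
Proof. exact: linearP. Qed.
End SubspFacts.

Section LinearConstructions.
Variables (k : fieldType) (V W : lmodType k).

Lemma linear_quot_lift (X : subsp V) (f : V -> W) : linear f ->
  (forall x, X x -> f x = 0) ->
  exists F : {linear quotT X -> W}, forall x, F (quot_proj X x) = f x.
Proof.
move=> hf h0; pose F (c : quotT X) := f (repr c).
have FE x : F (quot_proj X x) = f x.
  apply/eqP; rewrite -subr_eq0 -(linB hf); apply/eqP/h0; exact: quot_reprP.
have hF : linear F.
  move=> a; elim/proj_ind=> x; elim/proj_ind=> y.
  by rewrite -linearP !FE hf.
by exists (lin_pack hF).
Qed.

(** Two values over the same point differ by a value over 0, so single-valuedness need only be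
    assumed there. This builds maps on cohomology classes from a relation between arbitrary
    representatives. *)
Lemma linear_of_graph (R : V -> W -> Prop) :
  (forall x, exists y, R x y) -> (forall y, R 0 y -> y = 0) ->
  (forall a x y x' y', R x y -> R x' y' -> R (a *: x + x') (a *: y + y')) ->
  exists F : {linear V -> W}, forall x y, R x y <-> y = F x.
Proof.
move=> /choice[F hF] h0 hlin.
have huniq x y y' : R x y -> R x y' -> y = y'.
  move=> h h'; have := hlin (-1) _ _ _ _ h' h.
  rewrite !scaleN1r addNr addrC => /h0/eqP; rewrite subr_eq0 => /eqP; exact.
have Fl : linear F.
  by move=> a x y; apply: (huniq _ _ _ (hF _)); apply: hlin; exact: hF.
exists (lin_pack Fl) => x y; split=> [h|->]; last exact: hF.
exact: huniq h (hF x).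
Qed.
Lemma linear_bijective (F : {linear V -> W}) :
  (forall x, F x = 0 -> x = 0) -> (forall y, exists x, F x = y) -> bijective F.
Proof.
move=> hi /choice[G hG]; exists G => // x; apply/eqP; rewrite -subr_eq0.
by apply/eqP/hi; rewrite linearB hG subrr.
Qed.
End LinearConstructions.

(** * Generation and the metabelian identity *)

Section LieFacts.
Variables (k : fieldType) (V : lmodType k) (mu : lieBracket V).

(** The subspace A + g' contains A and every bracket, so it is everything. *)
Lemma generated_decomp (A : subsp V) : generated_by mu A ->
  forall x, exists2 a, A a & derived mu (x - a).
Proof.
move=> hA.
have h0 : exists2 a, A a & derived mu (0 - a).
  by exists 0; [exact: subsp0|rewrite subr0; exact: subsp0].
have hD x y : (exists2 a, A a & derived mu (x - a)) ->
    (exists2 a, A a & derived mu (y - a)) ->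
    exists2 a, A a & derived mu (x + y - a).
  move=> [a ha da] [b hb db]; exists (a + b); first exact: subspD.
  by rewrite opprD addrACA; apply: subspD.
have hZ c x : (exists2 a, A a & derived mu (x - a)) ->
    exists2 a, A a & derived mu (c *: x - a).
  move=> [a ha da]; exists (c *: a); first exact: subspZ.
  by rewrite -scalerBr; apply: subspZ.
apply: (hA (Subsp h0 hD hZ)) => [x hx|x y _ _].
  by exists x; rewrite ?subrr; [exact: hx|exact: subsp0].
by exists 0; [exact: subsp0|rewrite subr0; exact: mem_derived].
Qed.

Lemma metabelianP : metabelian mu <->
  forall x y, derived mu x -> derived mu y -> mu x y = 0.
Proof.
split=> [h x y hx hy|h z hz]; first by apply: h; exact: mem_brspan.
have h0 : (0 : V) = 0 by [].
have hD x y : x = 0 -> y = 0 -> x + y = 0 :> V by move=> -> ->; rewrite addr0.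
have hZ c x : x = 0 -> c *: x = 0 :> V by move=> ->; rewrite scaler0.
by apply: (hz (Subsp h0 hD hZ)) => /= _ [a [b [ha hb ->]]]; exact: h.
Qed.

(** Passage from brackets to their span is linear in one argument at a time. The four-variable form
    is the one in which deformed brackets satisfy the identity. *)
Lemma metabelian_br :
  (forall x y z t, mu (mu x y) (mu z t) = 0) <-> metabelian mu.
Proof.
split=> [h|/metabelianP h x y z t]; last by apply: h; exact: mem_derived.
apply/metabelianP => x y hx hy.
have hl z t w : derived mu w -> mu w (mu z t) = 0.
  move=> hw; apply: (hw (ker (lin_pack (lie_linl mu (mu z t))))).
  by move=> _ [a [b [_ _ ->]]]; exact: h.
apply: (hy (ker (lin_pack (lie_linr mu x)))).
by move=> _ [a [b [_ _ ->]]]; exact: hl.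
Qed.

End LieFacts.

(** * Universal property and grading of the free metabelian Lie algebra *)

Section FreeMetabelianFacts.
Variables (k : fieldType) (U : lmodType k).
Local Notation br := (metaLie_br U).

Lemma metaLie_generated :
  generated_by br (fun m => exists u, m = metaLie_gen u).
Proof.
move=> X hX hbr; elim/proj_ind=> x; elim/cls_ind: x.
elim=> [u||s hs t ht|a s hs|s hs t ht].
- by apply: hX; exists u.
- by rewrite cls0 linear0; exact: subsp0.
- by rewrite clsD linearD; exact: subspD.
- by rewrite clsZ linearZ; exact: subspZ.
- by rewrite -freeLie_brE -metaLie_brE; exact: hbr.
Qed.

Lemma metaLie_metabelian : metabelian br.
Proof.
apply/metabelian_br; elim/proj_ind=> x; elim/proj_ind=> y.
elim/proj_ind=> z; elim/proj_ind=> t; rewrite !metaLie_brE.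
rewrite -[RHS](linear0 (quot_proj _)); apply/projP; rewrite subr0.
by apply: mem_brspan; exact: mem_derived.
Qed.

Section Lift.
Variables (V : lmodType k) (mu : lieBracket V) (f : U -> V).
Hypotheses (flin : linear f) (hmet : metabelian mu).

(** A morphism sends the second derived ideal of Lie(U) into that of the metabelian target, which is
    zero, so the chosen representative does not matter. *)
Lemma metaLie_liftE x :
  metaLie_lift mu f (quot_proj (second_derived U) x) = freeLie_lift mu f x.
Proof.
have [hl hb _] := freeLie_universal mu flin.
apply/eqP; rewrite -subr_eq0 -(linB hl); apply/eqP; apply: hmet.
apply: (lin_span hl _ (quot_reprP _ x)) => _ [a [b [ha hb' ->]]].
have hd z : derived (freeLie_br U) z -> derived mu (freeLie_lift mu f z).
  apply: (lin_span hl) => _ [z1 [z2 [_ _ ->]]].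
  by rewrite hb; exact: mem_derived.
by rewrite hb; apply: mem_brspan; exact: hd.
Qed.

Lemma metaLie_universal :
  [/\ linear (metaLie_lift mu f),
      forall x y, metaLie_lift mu f (br x y)
                  = mu (metaLie_lift mu f x) (metaLie_lift mu f y)
    & forall u, metaLie_lift mu f (metaLie_gen u) = f u].
Proof.
have [hl hb hg] := freeLie_universal mu flin; split.
- move=> a; elim/proj_ind=> x; elim/proj_ind=> y.
  by rewrite -linearP !metaLie_liftE hl.
- elim/proj_ind=> x; elim/proj_ind=> y.
  by rewrite metaLie_brE !metaLie_liftE hb.
- by move=> u; rewrite metaLie_liftE.
Qed.
End Lift.

(** The kernel of [theta] contains the generators and is closed under brackets. Allowing [p] and
    [p'] to differ covers the difference of two morphisms as well as derivations along one
    morphism. *)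
Lemma derivation_along_eq0 (V : lmodType k) (mu : lieBracket V)
    (p p' theta : metaLie U -> V) : linear theta ->
  (forall a b, theta (br a b) = mu (p a) (theta b) + mu (theta a) (p' b)) ->
  (forall u, theta (metaLie_gen u) = 0) -> forall m, theta m = 0.
Proof.
move=> hl hb hg m; apply: (metaLie_generated (X := ker (lin_pack hl))).
  by move=> _ [u ->]; exact: hg.
by move=> x y /= hx hy; rewrite hb hx hy lie0l lie0r addr0.
Qed.

Lemma metaLie_deg_gen u : metaLie_deg U 1 (metaLie_gen u).
Proof. by apply: mem_span; constructor. Qed.

Lemma metaLie_deg_br i j x y : metaLie_deg U i x -> metaLie_deg U j y ->
  metaLie_deg U (i + j) (br x y).
Proof.
move=> hx hy; apply: (lin_span (lie_linl br y)) hx => {}x mx.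
apply: (lin_span (lie_linr br x)) hy => {}y my.
by apply: mem_span; constructor.
Qed.

Lemma metaLie_decomp m :
  exists u (b : metaB U), m = metaLie_gen u + val b.
Proof.
pose gen := lin_pack (@metaLie_gen_linear k U).
have hg : generated_by br (Defs.image gen fullsp).
  move=> X hX; apply: metaLie_generated => _ [u ->].
  by apply: hX; exists u.
have [_ [u _ ->] hd] := generated_decomp hg m.
by exists u, (inSub hd); rewrite inSubK addrC subrK.
Qed.
End FreeMetabelianFacts.

(** * Graded projections and the derived algebra *)

Section GradingFacts.
Variables (k : fieldType) (g : vectType k) (mu : lieBracket g).
Variable L : nat -> {vspace g}.
Hypothesis hgrad : positive_grading mu L.

Lemma graded_br i j x y : x \in L i -> y \in L j -> mu x y \in L (i + j)%N.
Proof. by case: hgrad => _ _; apply. Qed.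

Lemma graded_0 x : x \in L 0%N -> x = 0.
Proof. by case: hgrad => -> _ _; rewrite memv0 => /eqP. Qed.

Fact graded_projections_exist : exists p : (nat -> 'End(g)) * nat,
  [/\ forall i x, p.1 i x \in L i,
      forall i x, x \in L i -> p.1 i x = x,
      forall i j x, x \in L j -> i != j -> p.1 i x = 0
    & forall x, x = \sum_(i < p.2) p.1 i x].
Proof.
case: hgrad => _ [n [hn hd hf]] _.
(* The projections are indexed by all naturals and set to 0 from [n] on, where [L i] vanishes. *)
pose f i : 'End(g) := if insub i is Some j then sumv_pi_for (esym hf) (j : 'I_n) else 0.
have fE (j : 'I_n) : f j = sumv_pi_for (esym hf) j by rewrite /f valK.
have f0 i : (n <= i)%N -> f i = 0 by move=> h; rewrite /f insubN // -leqNgt.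
have fL i x : f i x \in L i.
  rewrite /f; case: insubP => [j _ <-|_]; first exact: memv_sum_pi.
  by rewrite zero_lfunE mem0v.
have fS x : x = \sum_(i < n) f i x.
  rewrite -[LHS](sumv_pi_sum (esym hf) (memvf x)).
  by apply: eq_bigr => i _; rewrite fE.
have hu i j x : x \in L j -> f i x = if i == j then x else 0.
  move=> hx; have [ni|ni] := leqP n i.
    rewrite f0 // zero_lfunE; case: eqP => // e.
    by move: hx; rewrite -e hn // memv0 => /eqP.
  have [nj|nj] := leqP n j.
    by move: hx; rewrite hn // memv0 => /eqP ->; rewrite linear0 if_same.
  pose u (l : 'I_n) := if l == Ordinal nj then x else 0.
  have hs : \sum_(l < n) u l = x by rewrite -big_mkcond big_pred1_eq.
  (* Directness forces the components of [x] to agree with the family [u] concentrated in degree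
     [j]. *)
  move/directv_sum_unique: hd => /(_ (fun l => f l x) u).
  rewrite -fS hs eqxx => /(_ (fun l _ => fL l x)) h.
  have {}h : true = [forall (l : 'I_n | true), f l x == u l].
    apply: h => l _; rewrite /u; case: eqP => [->|_] //; exact: mem0v.
  by move/esym/forall_inP/(_ (Ordinal ni) isT)/eqP: h => /= ->.
exists (f, n); split=> //= i.
- by move=> x hx; rewrite (hu i i) // eqxx.
- by move=> j x hx /negbTE e; rewrite (hu i j) // e.
Qed.

Definition gproj : nat -> 'End(g) := (projT1 (cid graded_projections_exist)).1.
Definition gbound : nat := (projT1 (cid graded_projections_exist)).2.

Lemma gproj_mem i x : gproj i x \in L i.
Proof. by rewrite /gproj; case: cid => p [h1 h2 h3 h4] /=; apply: h1. Qed.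

Lemma gproj_id i x : x \in L i -> gproj i x = x.
Proof. by rewrite /gproj; case: cid => p [h1 h2 h3 h4] /=; apply: h2. Qed.

Lemma gproj_neq i j x : x \in L j -> i != j -> gproj i x = 0.
Proof. by rewrite /gproj; case: cid => p [h1 h2 h3 h4] /=; apply: h3. Qed.

Lemma gproj_sum x : x = \sum_(i < gbound) gproj i x.
Proof. by rewrite /gproj /gbound; case: cid => p [h1 h2 h3 h4] /=; apply: h4. Qed.

Lemma br_gproj x y : mu x y =
  \sum_(i < gbound) \sum_(j < gbound) mu (gproj i x) (gproj j y).
Proof.
rewrite {1}(gproj_sum x) (lin_sum (lie_linl mu y)); apply: eq_bigr => i _.
by rewrite {1}(gproj_sum y) (lin_sum (lie_linr mu _)).
Qed.

(** Both arguments are expanded into components; the degree-0 ones vanish, which leaves successor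
    degrees. *)
Lemma graded_pair_ind (P : g -> g -> Prop) :
  (forall y, P 0 y) -> (forall x, P x 0) ->
  (forall x x' y, P x y -> P x' y -> P (x + x') y) ->
  (forall x y y', P x y -> P x y' -> P x (y + y')) ->
  (forall i j x y, x \in L i.+1 -> y \in L j.+1 -> P x y) -> forall x y, P x y.
Proof.
move=> h0l h0r hDl hDr h x y; rewrite (gproj_sum x) (gproj_sum y).
elim/big_ind: _ => [//|*|[[|i] /= _] _]; first exact: hDl.
  by rewrite (graded_0 (gproj_mem 0 x)).
elim/big_ind: _ => [//|*|[[|j] /= _] _]; first exact: hDr.
  by rewrite (graded_0 (gproj_mem 0 y)).
by apply: h; exact: gproj_mem.
Qed.

(** Both arguments have components in degrees at least 1, so the values live in degrees at least
    2. *)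
Lemma gproj1_alt2 (phi : g -> g -> g) x y :
  (forall y, linear (phi^~ y)) -> (forall x, linear (phi x)) ->
  (forall i j x y, x \in L i -> y \in L j -> phi x y \in L (i + j)%N) ->
  gproj 1 (phi x y) = 0.
Proof.
move=> hl hr hL; apply: (graded_pair_ind (P := fun x y => gproj 1 (phi x y) = 0)) => {x y}.
- by move=> y; rewrite (lin0 (hl y)) linear0.
- by move=> x; rewrite (lin0 (hr x)) linear0.
- by move=> x x' y; rewrite (linD (hl y)) linearD /= => -> ->; rewrite addr0.
- by move=> x y y'; rewrite (linD (hr x)) linearD /= => -> ->; rewrite addr0.
move=> i j x y hx hy; apply: gproj_neq (hL _ _ _ _ hx hy) _.
by rewrite addSn addnS.
Qed.

Lemma gproj1_br x y : gproj 1 (mu x y) = 0.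
Proof.
apply: gproj1_alt2; [exact: lie_linl|exact: lie_linr|exact: graded_br].
Qed.

Hypothesis hgen : generated_by mu (fun x => x \in L 1%N).

Definition vsubsp (X : {vspace g}) : subsp g :=
  @Subsp k g (fun x => x \in X) (mem0v X) (fun x y => @memvD _ _ X x y)
    (fun a x => @memvZ _ _ X a x).

(** Brackets have degree at least 2. Conversely, generation by L_1 gives x = a + d with a in L_1 and
    d in g', and the degree-1 projection of x is then a. *)
Lemma derivedP x : derived mu x <-> gproj 1 x = 0.
Proof.
have hd y : derived mu y -> gproj 1 y = 0.
  move=> hy; apply: (hy (ker (gproj 1))) => _ [a [b [_ _ ->]]].
  exact: gproj1_br.
split=> [|h]; first exact: hd.
have [a ha hxa] := generated_decomp (A := vsubsp (L 1%N)) hgen x.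
move: (hd _ hxa); rewrite linearB /= h sub0r (gproj_id ha) => /eqP.
by rewrite oppr_eq0 => /eqP a0; rewrite a0 subr0 in hxa.
Qed.

Lemma derived_graded i x : x \in L i.+2 -> derived mu x.
Proof. by move=> hx; apply/derivedP; exact: gproj_neq hx _. Qed.

Lemma derived_sum x :
  derived mu x <-> exists n, x \in (\sum_(2 <= i < n) L i)%VS.
Proof.
split=> [/derivedP hx|[n]].
  exists gbound; rewrite {1}(gproj_sum x) -(big_mkord predT (fun i => gproj i x)) /=.
  (* The terms of index 0 and 1 vanish, the former since [L 0] is zero and the latter by [hx];
     membership is therefore built up from index 2. *)
  have h (n : nat) : \sum_(0 <= i < n) gproj i x \in (\sum_(2 <= i < n) L i)%VS.
    elim: n => [|[|[|n]] IH]; rewrite ?big_nil ?mem0v //.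
    - by rewrite big_nat1 (graded_0 (gproj_mem 0 x)) mem0v.
    - by rewrite big_nat_recr //= big_nat1 (graded_0 (gproj_mem 0 x)) hx addr0 mem0v.
    - rewrite big_nat_recr //= (big_nat_recr n.+2) //=.
      by apply: memv_add => //; exact: gproj_mem.
  exact: h.
elim: n x => [|n IH] x; first by rewrite big_nil memv0 => /eqP ->; exact: subsp0.
have [n2|n2] := ltnP n 2.
  by rewrite big_geq // memv0 => /eqP ->; exact: subsp0.
rewrite big_nat_recr // => /memv_addP[y hy [z hz ->]].
apply: subspD; first exact: IH.
by case: n n2 hz {IH hy} => [|[|n]] // _; exact: derived_graded.
Qed.

(** This is what makes the mixed terms of the deformed metabelian identity fall into [g', g'] =
    0. *)
Lemma alt2_derived (phi : g -> g -> g) x y : C2_0 L phi -> derived mu (phi x y).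
Proof. by move=> [h1 h2 _ h4]; apply/derivedP; exact: gproj1_alt2. Qed.

Lemma cochain1_gproj (f : g -> g) i x : C1_0 L f -> gproj i (f x) = f (gproj i x).
Proof.
move=> [hl hL]; rewrite {1}(gproj_sum x) (lin_sum hl) linear_sum /=.
rewrite (eq_bigr (fun j : 'I_gbound => f (gproj i (gproj j x)))).
  by rewrite -(lin_sum hl) -linear_sum -gproj_sum.
move=> j _; have hj := gproj_mem j x.
have [<-|nij] := eqVneq (j : nat) i.
  by rewrite (gproj_id (hL _ _ hj)) (gproj_id hj).
by rewrite eq_sym in nij; rewrite (gproj_neq (hL _ _ hj)) // (gproj_neq hj) // (lin0 hl).
Qed.

Lemma cochain1_derived (f : g -> g) x : C1_0 L f -> derived mu x -> derived mu (f x).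
Proof.
by move=> hf /derivedP hx; apply/derivedP; rewrite cochain1_gproj // hx (lin0 hf.1).
Qed.

End GradingFacts.

(** * Graded metabelian deformations *)

Lemma coord_inj (k : fieldType) (V : vectType k) (x y : V) :
  (forall i, coord (vbasis {:V}) i x = coord (vbasis {:V}) i y) -> x = y.
Proof.
move=> h; rewrite (coord_vbasis (memvf x)) (coord_vbasis (memvf y)).
by apply: eq_bigr => i _; rewrite h.
Qed.

(* [ring] does not handle modules; this reduces to scalars. *)
Ltac coord_ring :=
  apply: coord_inj => ?; rewrite ?(linearD, linearN, linear0, linearZ) /=; ring.

Section Deformations.
Variables (k : fieldType) (g : vectType k) (mu : lieBracket g).
Variable L : nat -> {vspace g}.
Hypothesis hgrad : positive_grading mu L.
Hypothesis hmet : metabelian mu.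
Hypothesis hgen : generated_by mu (fun x => x \in L 1%N).

Lemma derived_br0 x y : derived mu x -> derived mu y -> mu x y = 0.
Proof. by move/metabelianP: hmet; apply. Qed.

Lemma alt2_antisym (phi : g -> g -> g) x y : C2_0 L phi -> phi x y = - phi y x.
Proof.
move=> [hl hr ha _]; apply/eqP; rewrite -addr_eq0; apply/eqP.
have := ha (x + y).
by rewrite (linD (hl _)) !(linD (hr _)) !ha add0r addr0.
Qed.

(** By antisymmetry the differential takes the cyclic form that occurs as the [eps]-coefficient of
    the Jacobi identity. *)
Lemma ce2_cyclic (phi : g -> g -> g) x y z : C2_0 L phi ->
  ce2 mu phi x y z = mu x (phi y z) + mu y (phi z x) + mu z (phi x y)
    + (phi x (mu y z) + phi y (mu z x) + phi z (mu x y)).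
Proof.
move=> hphi; have [hl hr _ _] := hphi.
rewrite /ce2 (alt2_antisym z x hphi) (alt2_antisym x (mu y z) hphi).
rewrite (alt2_antisym y (mu z x) hphi) (alt2_antisym z (mu x y) hphi).
by rewrite (lieC mu x z) (linN (hl _)) lieNr; coord_ring.
Qed.

Lemma ce1_C2 (f : g -> g) : C1_0 L f -> C2_0 L (ce1 mu f).
Proof.
move=> [hl hL]; split.
- move=> y a x z; rewrite /ce1 hl lieDl lieZl lieDl lieZl hl lieDr lieZr.
  by rewrite !scalerBr; coord_ring.
- move=> x a y z; rewrite /ce1 hl lieDl lieZl !lieDr !lieZr hl.
  by rewrite !scalerBr; coord_ring.
- by move=> x; rewrite /ce1 lie_alt subrr (lin0 hl) subr0.
- move=> i j x y hx hy; rewrite /ce1; apply: memvB; last first.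
    by apply: hL; exact: (graded_br hgrad).
  apply: memvB; first by apply: (graded_br hgrad) => //; exact: hL.
  by rewrite addnC; apply: (graded_br hgrad) => //; exact: hL.
Qed.

Lemma ce1_cocycle (f : g -> g) : C1_0 L f -> ce2 mu (ce1 mu f) = 0.
Proof.
move=> hf; apply/funext => x; apply/funext => y; apply/funext => z.
have [hl _] := hf.
rewrite (ce2_cyclic _ _ _ (ce1_C2 hf)) /ce1.
rewrite !lieDr !lieNr (lieC mu (mu y z) (f x)) (lieC mu (mu z x) (f y)).
rewrite (lieC mu (mu x y) (f z)).
have j1 := lie_jacobi mu (f x) y z.
have j2 := lie_jacobi mu x (f y) z.
have j3 := lie_jacobi mu x y (f z).
have j4 : f (mu x (mu y z)) + f (mu y (mu z x)) + f (mu z (mu x y)) = 0.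
  by rewrite -!(linD hl) lie_jacobi (lin0 hl).
rewrite (lieC mu (f x) y) lieNr in j1.
rewrite (lieC mu (f y) z) lieNr in j2.
rewrite (lieC mu (f z) x) lieNr in j3.
change ((0 : g -> g -> g -> g) x y z) with (0 : g).
(* The target 0 is expanded into the Jacobi sums with [f] applied to one argument, minus the image
   under [f] of the Jacobi sum; what remains is linear rearrangement. *)
rewrite -[RHS]addr0 -[RHS]addr0 -[RHS]addr0 -{1}j1 -{1}j2 -{1}j3 -{1}oppr0 -{1}j4.
coord_ring.
Qed.

(** A degree-zero [f] preserves g', so each term of its coboundary on two elements of g' involves a
    bracket inside g'. *)
Lemma ce1_vanishes (f : g -> g) : C1_0 L f -> vanishes_on_L2d mu (ce1 mu f).
Proof.
move=> hf x y hx hy; have hd := cochain1_derived hgrad hgen hf.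
rewrite /ce1 !derived_br0 //; try exact: hd.
by rewrite (lin0 hf.1) !subr0.
Qed.

Lemma B2_vanishes phi : B2_0 mu L phi -> Z2_0 mu L phi /\ vanishes_on_L2d mu phi.
Proof.
move=> [f hf ->]; split; last exact: ce1_vanishes.
by split; [exact: ce1_C2|exact: ce1_cocycle].
Qed.

Lemma vanishes_on_L2dP phi : C2_0 L phi ->
  (vanishes_on_L2d mu phi <-> forall x y z t, phi (mu x y) (mu z t) = 0).
Proof.
move=> [hl hr _ _]; split=> [h x y z t|h x y hx hy].
  by apply: h; exact: mem_derived.
apply: (hx (ker (lin_pack (hl y)))) => _ [a [b [_ _ ->]]].
by apply: (hy (ker (lin_pack (hr (mu a b))))) => _ [c [d [_ _ ->]]]; exact: h.
Qed.

(** Arguments without [eps]-part isolate the cocycle identity. For general arguments the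
    [eps]-coefficient is that identity plus three Jacobi sums of [mu], each with one [eps]-part
    inserted. *)
Lemma def_jacobi phi : C2_0 L phi ->
  (forall x y z, def_br mu phi x (def_br mu phi y z)
     + def_br mu phi y (def_br mu phi z x)
     + def_br mu phi z (def_br mu phi x y) = 0) <-> ce2 mu phi = 0.
Proof.
move=> hphi; split=> [h|h x y z].
  apply/funext => x; apply/funext => y; apply/funext => z.
  rewrite ce2_cyclic //; have := congr1 snd (h (x, 0) (y, 0) (z, 0)).
  rewrite /def_br /= !lie0l !lie0r !add0r => e.
  by apply: etrans e; coord_ring.
have hc : ce2 mu phi x.1 y.1 z.1 = 0 by rewrite h.
rewrite ce2_cyclic // in hc.
have j1 := lie_jacobi mu x.1 y.1 z.2.
have j2 := lie_jacobi mu x.1 y.2 z.1.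
have j3 := lie_jacobi mu x.2 y.1 z.1.
rewrite /def_br; apply: injective_projections => /=; first exact: lie_jacobi.
rewrite -[RHS]addr0 -[RHS]addr0 -[RHS]addr0 -{1}j1 -{1}j2 -{1}j3 -{1}hc.
rewrite !lieDr; coord_ring.
Qed.

(** The [eps]-coefficient is [phi] on two brackets plus brackets of [mu] inside g', and the latter
    vanish. *)
Lemma def_metabelian phi : C2_0 L phi ->
  (forall x y z t, def_br mu phi (def_br mu phi x y) (def_br mu phi z t) = 0)
  <-> vanishes_on_L2d mu phi.
Proof.
move=> hphi; rewrite (vanishes_on_L2dP hphi); split=> [h x y z t|h x y z t].
  have := congr1 snd (h (x, 0) (y, 0) (z, 0) (t, 0)).
  rewrite /def_br /= !lie0l !lie0r !add0r derived_br0 ?add0r; last 2 first.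
  - exact: mem_derived.
  - exact: (alt2_derived hgrad hgen).
  rewrite derived_br0 ?add0r //; last exact: mem_derived.
  exact: (alt2_derived hgrad hgen).
rewrite /def_br; apply: injective_projections => /=.
  by apply: derived_br0; exact: mem_derived.
have hd (u v : g * g) :
    derived mu (mu u.1 v.2 + mu u.2 v.1 + phi u.1 v.1).
  apply: (subspD _ (alt2_derived hgrad hgen _ _ hphi)).
  by apply: (@subspD _ _ (derived mu)); exact: mem_derived.
by rewrite h (derived_br0 (mem_derived _ _) (hd _ _))
  (derived_br0 (hd _ _) (mem_derived _ _)) !addr0.
Qed.

Lemma metabelian_deformationP phi : metabelian_deformation mu L phi <->
  Z2_0 mu L phi /\ vanishes_on_L2d mu phi.
Proof.
split=> [[h1 h2 h3]|[[h1 h2] h3]].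
  by split; [split=> //; apply/def_jacobi|apply/def_metabelian].
by split=> //; [apply/def_jacobi|apply/def_metabelian].
Qed.

(** The map id + [eps] f intertwines the two brackets exactly when the [eps]-coefficients agree,
    that is, when phi - phi' is the coboundary of f. *)
Lemma equiv_deformationP phi phi' :
  equiv_deformation mu L phi phi' <-> B2_0 mu L (phi - phi').
Proof.
split=> -[f hf h]; exists f => //.
  apply/funext => x; apply/funext => y.
  have := congr1 snd (h (x, 0) (y, 0)).
  rewrite /def_br /ce1 /= !lie0l !lie0r !add0r (lieC mu (f x)) => /(canRL (addrK _)) e.
  by rewrite !fctE e; coord_ring.
move=> F x y; rewrite /F /def_br; apply: injective_projections => //=.
have := congr1 (fun p => p x.1 y.1) h; rewrite /ce1 !fctE => /(canRL (subrK _)) ->.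
by rewrite !lieDr !lieDl (lieC mu (f x.1)); coord_ring.
Qed.

(** * The deformed Lie algebra over the dual numbers *)

Section DeformedBracket.
Variables (phi : g -> g -> g) (hdef : metabelian_deformation mu L phi).

Fact def_br_linl y : linear (def_br mu phi ^~ y).
Proof.
have [[hl hr ha _] _ _] := hdef; move=> a x x'; rewrite /def_br.
apply: injective_projections => /=; first by rewrite lieDl lieZl.
by rewrite !lieDl !lieZl hl !scalerDr; coord_ring.
Qed.
Fact def_br_linr x : linear (def_br mu phi x).
Proof.
have [[hl hr ha _] _ _] := hdef; move=> a y y'; rewrite /def_br.
apply: injective_projections => /=; first by rewrite lieDr lieZr.
by rewrite !lieDr !lieZr hr !scalerDr; coord_ring.
Qed.
Fact def_br_alt x : def_br mu phi x x = 0.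
Proof.
have [[hl hr ha _] _ _] := hdef; rewrite /def_br lie_alt ha addr0.
by rewrite (lieC mu x.2) subrr.
Qed.
(** The algebra g[eps] is regarded as a Lie algebra over [k], so that the universal property of M(U)
    over [k] applies to it. *)
Definition def_lie : lieBracket (g * g)%type :=
  LieBracket def_br_linl def_br_linr def_br_alt
    (let: And3 _ h _ := hdef in h).

Lemma def_lie_metabelian : metabelian def_lie.
Proof. by apply/metabelian_br; case: hdef. Qed.
End DeformedBracket.

(** * The restriction map on second cohomology *)

Fact restriction_hom_L2d (phi : subT (Z2_0 mu L)) :
  hom_L2d mu L (fun x y : subT (derived mu) => val phi (val x) (val y)).
Proof.
have [[hl hr ha hL] _] := subTP phi; split.
- by move=> y a x x'; rewrite -hl.
- by move=> x a y y'; rewrite -hr.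
- by move=> x; exact: ha.
- by move=> i j x y; exact: hL.
Qed.

Lemma restriction_exists : exists Delta : {linear H2_0 mu L -> subT (hom_L2d mu L)},
  forall (phi : subT (Z2_0 mu L)) (x y : subT (derived mu)),
    val (Delta (H2_0_class phi)) x y = val phi (val x) (val y).
Proof.
pose f phi := inSub (restriction_hom_L2d phi).
have fl : linear f.
  move=> a p p'; apply: val_inj; apply/funext => x; apply/funext => y.
  change (val (a *: p + p') (val x) (val y)
    = a *: val p (val x) (val y) + val p' (val x) (val y)).
  by rewrite (@val_linear _ _ (Z2_0 mu L)).
have f0 phi : B2_0_in_Z2_0 mu L phi -> f phi = 0.
  move=> hB; have [_ h] := @B2_vanishes (val phi) hB.
  by apply: val_inj; apply/funext => x; apply/funext => y; apply: h; exact: subTP.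
have [F hF] := linear_quot_lift fl f0.
by exists F => phi x y; rewrite [F _]hF.
Qed.

Lemma ker_restriction (Delta : {linear H2_0 mu L -> subT (hom_L2d mu L)}) :
  (forall (phi : subT (Z2_0 mu L)) (x y : subT (derived mu)),
    val (Delta (H2_0_class phi)) x y = val phi (val x) (val y)) ->
  forall phi : subT (Z2_0 mu L),
    ker Delta (H2_0_class phi) <-> vanishes_on_L2d mu (val phi).
Proof.
move=> hD phi; split=> [h x y hx hy|h].
  by have := hD phi (inSub hx) (inSub hy); rewrite h => <-.
apply: val_inj; apply/funext => x; apply/funext => y.
by rewrite hD h //; exact: subTP.
Qed.

End Deformations.

(** * The universal map and its graded section *)

Section UniversalMap.
Variables (k : fieldType) (g : vectType k) (mu : lieBracket g).
Variable L : nat -> {vspace g}.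
Hypothesis hgrad : positive_grading mu L.
Hypothesis hmet : metabelian mu.
Hypothesis hgen : generated_by mu (fun x => x \in L 1%N).
Local Notation U := (subvs_of (L 1%N)).
Local Notation br := (metaLie_br U).
Local Notation univ := (@univ_map k g mu L).

Lemma univ_linear : linear univ.
Proof. by have [] := metaLie_universal (linearP (vsval : U -> g)) hmet. Qed.

Lemma univ_br a b : univ (br a b) = mu (univ a) (univ b).
Proof. by have [_ + _] := metaLie_universal (linearP (vsval : U -> g)) hmet; apply. Qed.

Lemma univ_gen u : univ (metaLie_gen u) = vsval u.
Proof. by have [_ _] := metaLie_universal (linearP (vsval : U -> g)) hmet; apply. Qed.

(** The induction on monomials carries the degree of [univ] along with that of [theta], because the
    bracket rule for [theta] may involve both. *)
Lemma graded_along (theta : metaLie U -> g) : linear theta ->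
  (forall u, theta (metaLie_gen u) \in L 1%N) ->
  (forall i j a b, univ a \in L i -> univ b \in L j ->
     theta a \in L i -> theta b \in L j -> theta (br a b) \in L (i + j)%N) ->
  forall i m, metaLie_deg U i m -> univ m \in L i /\ theta m \in L i.
Proof.
move=> hl hg hb i m hm.
have h x : monomial i x -> univ x \in L i /\ theta x \in L i.
  elim=> {i m x hm} [u|i j x y _ [hx hx'] _ [hy hy']].
    by rewrite univ_gen subvsP; split.
  by rewrite univ_br (graded_br hgrad) // hb.
split.
  by apply: (lin_span (Y := vsubsp (L i)) univ_linear _ hm) => x /h[].
by apply: (lin_span (Y := vsubsp (L i)) hl _ hm) => x /h[].
Qed.

Lemma univ_deg i m : metaLie_deg U i m -> univ m \in L i.
Proof.
move=> hm; have [] // := graded_along univ_linear _ _ hm => [u|i' j a b ha hb _ _].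
  by rewrite univ_gen subvsP.
by rewrite univ_br (graded_br hgrad).
Qed.

(** Write m = u + b with u a generator and b in B(U). If the image of m lies in g', so does u, and
    L_1 meets g' in 0. *)
Lemma univ_derived m : derived mu (univ m) <-> derived br m.
Proof.
have h x : derived br x -> derived mu (univ x).
  apply: (lin_span univ_linear) => _ [a [b [_ _ ->]]].
  by rewrite univ_br; exact: mem_derived.
split=> [hm|]; last exact: h.
have [u [b e]] := metaLie_decomp m.
have : derived mu (vsval u).
  rewrite -univ_gen -[metaLie_gen u](addrK (val b)) -e (linB univ_linear).
  by apply: subspB => //; apply: h; exact: subTP.
move/(derivedP hgrad hgen); rewrite (gproj_id hgrad (subvsP u)) => u0.
have -> : m = val b.
  suff -> : m = 0 + val b by rewrite add0r.
  rewrite {1}e; congr (_ + _); rewrite -(lin0 (@metaLie_gen_linear k U)).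
  by congr metaLie_gen; apply: subvs_inj; rewrite u0 linear0.
exact: subTP.
Qed.

(** The elements all of whose components have homogeneous preimages of the same degree form a
    subalgebra containing L_1. *)
Lemma graded_univ i x : x \in L i -> exists2 m, metaLie_deg U i m & univ m = x.
Proof.
pose im j := Defs.image (lin_pack univ_linear) (metaLie_deg U j).
pose P y := forall j, im j (gproj hgrad j y).
have h0 : P 0 by move=> j; rewrite linear0; exact: subsp0.
have hD y z : P y -> P z -> P (y + z).
  by move=> hy hz j; rewrite linearD; apply: subspD; [exact: hy|exact: hz].
have hZ c y : P y -> P (c *: y).
  by move=> hy j; rewrite linearZ_LR; apply: subspZ; exact: hy.
have hP : forall y, P y.
  apply: (hgen (X := Subsp h0 hD hZ)) => [y hy j|y z hy hz j].
    have [->|nj] := eqVneq j 1%N; last first.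
      by rewrite (gproj_neq hgrad hy) //; exact: subsp0.
    rewrite (gproj_id hgrad hy); exists (metaLie_gen (vsproj (L 1%N) y)).
      exact: metaLie_deg_gen.
    by rewrite [RHS]univ_gen vsprojK.
  rewrite (br_gproj hgrad) linear_sum; apply: subsp_sum => i1 _.
  rewrite linear_sum; apply: subsp_sum => i2 _.
  change (im j (gproj hgrad j (mu (gproj hgrad i1 y) (gproj hgrad i2 z)))).
  have hm := graded_br hgrad (gproj_mem hgrad i1 y) (gproj_mem hgrad i2 z).
  have [->|nj] := eqVneq j (i1 + i2)%N; last first.
    by rewrite (gproj_neq hgrad hm) //; exact: subsp0.
  rewrite (gproj_id hgrad hm).
  have [a ha ->] := hy i1; have [b hb ->] := hz i2.
  by exists (br a b); [exact: metaLie_deg_br|rewrite [RHS]univ_br].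
move=> hx; have [m hm e] := hP x i; exists m => //.
by rewrite (gproj_id hgrad hx) in e.
Qed.

(** In degree 1 the section is the inclusion of generators; in every other degree a basis of [L i]
    is lifted. The pieces are summed over the graded projections. *)
Fact graded_section_exists : exists s : g -> metaLie U,
  [/\ linear s, forall x, univ (s x) = x,
      forall i x, x \in L i -> metaLie_deg U i (s x)
    & forall u, s (vsval u) = metaLie_gen u].
Proof.
have /choice[t ht] (i : nat) : exists t : g -> metaLie U,
    [/\ linear t, forall x, x \in L i -> metaLie_deg U i (t x),
        forall x, x \in L i -> univ (t x) = x
      & i = 1%N -> forall u, t (vsval u) = metaLie_gen u].
  have [->|i1] := eqVneq i 1%N.
    exists (fun x => metaLie_gen (vsproj (L 1%N) x)); split.
    - by move=> a x y; rewrite linearP metaLie_gen_linear.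
    - by move=> x _; exact: metaLie_deg_gen.
    - by move=> x hx; rewrite univ_gen vsprojK.
    - by move=> _ u; rewrite vsvalK.
  have /choice[b hb] (j : 'I_(\dim (L i))) : exists m,
      metaLie_deg U i m /\ univ m = (vbasis (L i))`_j.
    have [|m h1 h2] := @graded_univ i (vbasis (L i))`_j; last by exists m.
    by rewrite vbasis_mem // memt_nth.
  exists (fun x => \sum_j coord (vbasis (L i)) j x *: b j); split.
  - move=> a x y; rewrite scaler_sumr -big_split; apply: eq_bigr => j _ /=.
    by rewrite linearP scalerDl scalerA.
  - by move=> x _; apply: subsp_sum => j _; apply: subspZ; case: (hb j).
  - move=> x hx; rewrite (lin_sum univ_linear) [RHS](coord_vbasis hx).
    by apply: eq_bigr => j _; rewrite (linZ univ_linear); case: (hb j) => _ ->.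
  - by move=> e; rewrite e in i1.
exists (fun x => \sum_(i < gbound hgrad) t i (gproj hgrad i x)); split.
- move=> a x y; rewrite scaler_sumr -big_split; apply: eq_bigr => j _ /=.
  by rewrite linearP; case: (ht j) => tl _ _ _; rewrite tl.
- move=> x; rewrite (lin_sum univ_linear) [RHS](gproj_sum hgrad).
  by apply: eq_bigr => j _; case: (ht j) => _ _ + _; apply; exact: gproj_mem.
- move=> i x hx; apply: subsp_sum => j _; case: (ht j) => tl td _ _.
  have [<-|nj] := eqVneq (j : nat) i; first by apply: td; exact: gproj_mem.
  by rewrite (gproj_neq hgrad hx nj) (lin0 tl); exact: subsp0.
- move=> u; have hu := subvsP u.
  have h0 (j : 'I_(gbound hgrad)) : (j : nat) != 1%N -> gproj hgrad j (vsval u) = 0.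
    by move=> nj; rewrite (gproj_neq hgrad hu nj).
  have [n1|n1] := ltnP 1 (gbound hgrad).
    rewrite (bigD1 (Ordinal n1)) //= big1 ?addr0 => [|j nj].
      by rewrite (gproj_id hgrad hu); case: (ht 1%N) => _ _ _; apply.
    by rewrite h0 // (lin0 (let: And4 h _ _ _ := ht j in h)).
  (* If the bound is at most 1, the sum has no degree-1 term; then [L 1] is zero and so is [u]. *)
  have u0 : u = 0.
    apply: subvs_inj; rewrite linear0 [LHS](gproj_sum hgrad) big1 // => j _.
    by apply: h0; rewrite neq_ltn (leq_trans (ltn_ord j) n1).
  rewrite u0 (lin0 (@metaLie_gen_linear k U)) big1 // => j _.
  by rewrite !linear0 (lin0 (let: And4 h _ _ _ := ht j in h)).
Qed.

Definition gsec : g -> metaLie U := projT1 (cid graded_section_exists).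

Lemma gsec_linear : linear gsec.
Proof. by rewrite /gsec; case: cid => s []. Qed.

Lemma gsecK x : univ (gsec x) = x.
Proof. by rewrite /gsec; case: cid => s []. Qed.

Lemma gsec_deg i x : x \in L i -> metaLie_deg U i (gsec x).
Proof. by rewrite /gsec; case: cid => s [/= _ _ h _]; exact: h. Qed.

Lemma gsec_gen u : gsec (vsval u) = metaLie_gen u.
Proof. by rewrite /gsec; case: cid => s []. Qed.

Lemma gsec_derived x : derived mu x -> derived br (gsec x).
Proof. by move=> hx; apply/univ_derived; rewrite gsecK. Qed.

(** The element m - s(univ m) lies in the kernel of [univ], so F o s is the map induced by F on
    g. *)
Lemma descend (F : metaLie U -> g) : linear F ->
  (forall m, univ m = 0 -> F m = 0) -> forall m, F (gsec (univ m)) = F m.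
Proof.
move=> Fl F0 m; apply/eqP; rewrite -subr_eq0 -(linB Fl); apply/eqP/F0.
by rewrite (linB univ_linear) gsecK subrr.
Qed.

Lemma descend_cochain1 (F : metaLie U -> g) : linear F ->
  (forall i m, metaLie_deg U i m -> F m \in L i) ->
  C1_0 L (fun x => F (gsec x)).
Proof.
move=> Fl Fd; split=> [a x y|i x hx]; first by rewrite gsec_linear Fl.
by apply: Fd; exact: gsec_deg.
Qed.
End UniversalMap.

(** * Variations of the relation module *)

Section RelationVariations.
Variables (k : fieldType) (g : vectType k) (mu : lieBracket g).
Variable L : nat -> {vspace g}.
Hypothesis hgrad : positive_grading mu L.
Hypothesis hmet : metabelian mu.
Hypothesis hgen : generated_by mu (fun x => x \in L 1%N).
Local Notation U := (subvs_of (L 1%N)).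
Local Notation br := (metaLie_br U).
Local Notation univ := (@univ_map k g mu L).
Variables (h : nat -> nat) (q : quot_point U h).
Hypothesis hq : corresponds mu q.

Let ulin := univ_linear (L := L) hmet.
Let ubr := univ_br (L := L) hmet.
Let ugen := univ_gen (L := L) hmet.
Let s := gsec hgrad hmet hgen.
Let slin : linear s := gsec_linear hgrad hmet hgen.
Let sK x : univ (s x) = x := gsecK hgrad hmet hgen x.

Lemma univ_derived_B (b : metaB U) : derived mu (univ (val b)).
Proof. by apply/(univ_derived hgrad hmet hgen); exact: subTP. Qed.

Lemma qkerP b : qker q b <-> univ (val b) = 0.
Proof.
split=> [hb|/hq[b' hb' /val_inj -> //]].
by apply/hq; exists b.
Qed.

Lemma univ_qN (n : qN q) : univ (val (val n)) = 0.
Proof. by apply/qkerP; exact: subTP. Qed.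

Lemma qN_of m : univ m = 0 -> exists n : qN q, val (val n) = m.
Proof. by move=> /hq[b hb ->]; exists (inSub hb). Qed.

(** This is the isomorphism of C with g', viewed as a map into g so that identities in C can be
    checked in g. *)
Definition qemb (c : qC q) : g := univ (val (repr c)).

Lemma qemb_qmap b : qemb (qmap q b) = univ (val b).
Proof.
apply/eqP; rewrite -subr_eq0 -(linB ulin); apply/eqP.
have := quot_reprP (qker q) b.
by move/qkerP; rewrite (linB (@val_linear _ _ (derived br))).
Qed.

Lemma qemb_linear : linear qemb.
Proof.
move=> a; elim/proj_ind=> x; elim/proj_ind=> y.
rewrite -!/(qmap q _) -linearP !qemb_qmap.
by rewrite (@val_linear _ _ (derived br)) ulin.
Qed.

Lemma qemb_inj : injective qemb.
Proof.
move=> c c' e; rewrite -[c]reprK -[c']reprK; apply/projP/qkerP.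
by rewrite (linB (@val_linear _ _ (derived br))) (linB ulin) [univ _]e subrr.
Qed.

Lemma qemb_uact u c : qemb (qC_uact u c) = mu (vsval u) (qemb c).
Proof.
elim/proj_ind: c => b; rewrite -/(qmap q b) qC_uactE !qemb_qmap.
by rewrite /metaB_act inSubK ubr ugen.
Qed.

Lemma qemb_deg r c : Defs.image (qmap q) (metaB_deg U r) c -> qemb c \in L r.+2.
Proof. by move=> [b hb ->]; rewrite qemb_qmap; exact: (univ_deg hgrad hmet). Qed.

(* A morphism M(U) -> (g[eps], mu + eps phi) over [univ], trivial on generators,
   has [theta] as its [eps]-component. *)
Definition lifts (phi : g -> g -> g) (theta : metaLie U -> g) : Prop :=
  [/\ linear theta, forall u, theta (metaLie_gen u) = 0
    & forall a b, theta (br a b) =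
        mu (univ a) (theta b) + mu (theta a) (univ b) + phi (univ a) (univ b)].

(** The kernel condition theta(n) + univ(b) = 0 says that the class of b embeds in g as -theta(n);
    injectivity of [qemb] then determines this class. *)
Lemma relation_variationP phi (psi : qN q -> qC q) :
  relation_variation mu phi psi <->
  exists2 theta, lifts phi theta & forall n, qemb (psi n) = - theta (val (val n)).
Proof.
split=> [[theta tl [tg tb tpsi]]|[theta [tl tg tb] tpsi]]; exists theta => //.
- split=> // [u|a b]; first by case: (tg u).
  by case: (tb a b).
- move=> n; apply/eqP; rewrite -addr_eq0 addrC; apply/eqP.
  by apply/tpsi; rewrite /qmap /quot_proj reprK.
- split=> [u|a b|n b]; first by rewrite tg ugen.
    by rewrite tb ubr /def_br.
  rewrite -qemb_qmap addrC; split=> [<-|/eqP]; first by rewrite tpsi addNr.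
  by rewrite addr_eq0 -tpsi => /eqP/qemb_inj.
Qed.

Lemma lifts_deg phi theta i m : C2_0 L phi -> lifts phi theta ->
  metaLie_deg U i m -> theta m \in L i.
Proof.
move=> [_ _ _ hL] [tl tg tb] hm.
have [] // := graded_along hgrad hmet tl _ _ hm => [u|i' j a b ha hb ta tb'].
  by rewrite tg mem0v.
by rewrite tb; apply: memvD; [apply: memvD; exact: (graded_br hgrad)|exact: hL].
Qed.

Lemma lifts_derived phi theta m : C2_0 L phi -> lifts phi theta ->
  derived br m -> derived mu (theta m).
Proof.
move=> hphi [tl tg tb]; apply: (lin_span tl) => _ [a [b [_ _ ->]]].
rewrite tb; apply: (subspD _ (alt2_derived hgrad hgen _ _ hphi)).
by apply: (@subspD _ _ (derived mu)); exact: mem_derived.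
Qed.

(** The inclusion of generators extends to a morphism into the deformed algebra, which is again
    metabelian; [theta] is its second component. *)
Lemma lifts_exists phi : metabelian_deformation mu L phi -> exists theta, lifts phi theta.
Proof.
move=> hdef.
pose f (u : U) : g * g := (vsval u, 0).
have fl : linear f.
  move=> a u v; rewrite /f; apply: injective_projections => /=.
    exact: (linearP vsval).
  by rewrite scaler0 addr0.
have [Pl Pb Pg] := metaLie_universal fl (@def_lie_metabelian _ _ _ _ _ hdef).
set P := metaLie_lift _ _ in Pl Pb Pg.
(* Both are morphisms to g agreeing on generators, so their difference vanishes. *)
have P1 m : (P m).1 = univ m.
  apply/eqP; rewrite -subr_eq0; apply/eqP; move: m.
  apply: (@derivation_along_eq0 _ _ _ mu (fun m => (P m).1) univ).
  - by move=> a x y; rewrite Pl ulin /= scalerBr; coord_ring.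
  - move=> a b; rewrite Pb ubr /= lieDr lieDl lieNr lieNl; coord_ring.
  - by move=> u; rewrite Pg ugen subrr.
exists (fun m => (P m).2); split=> [a x y|u|a b].
- by rewrite Pl.
- by rewrite Pg.
- by rewrite Pb /= !P1.
Qed.

Lemma variation_exists phi : metabelian_deformation mu L phi ->
  exists psi : subT (homR0 q), relation_variation mu phi (val psi).
Proof.
move=> hdef; have hphi : C2_0 L phi by case: hdef.
have [theta ht] := lifts_exists hdef; have [tl tg tb] := ht.
(* On B(U) the values of [theta] lie in g', so their sections lie in B(U) and define classes in
   C. *)
have hd (b : metaB U) : derived br (s (- theta (val b))).
  apply: gsec_derived; apply: subspN; apply: (lifts_derived hphi ht).
  exact: subTP.
pose f b := qmap q (inSub (hd b)).
have fE b : qemb (f b) = - theta (val b) by rewrite qemb_qmap inSubK sK.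
have fl : linear f.
  move=> a x y; apply: qemb_inj; rewrite qemb_linear !fE.
  by rewrite (@val_linear _ _ (derived br)) tl scalerN -opprD.
have hR : homR0 q (fun n : qN q => f (val n)).
  split.
  - by move=> a x y; rewrite (@val_linear _ _ (qker q)) fl.
  - move=> P n.
    apply: (@sym_act_morph _ _ _ _ (qker q) f (@metaB_act k U) (@qC_uact _ _ _ q)
      fl _ _ P (val n) (subTP n)).
      by move=> u v; exact: qker_act.
    (* For v in N the terms containing [univ v] drop out of the bracket rule, which leaves the
       action of u. *)
    move=> u v hv; apply: qemb_inj; rewrite qemb_uact !fE /metaB_act inSubK tb.
    have /qkerP -> := hv.
    have [_ hr _ _] := hphi.
    by rewrite tg lie0l addr0 (lin0 (hr _)) addr0 lieNr ugen.
  - move=> r n hn; exists (inSub (hd (val n))) => //.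
    apply: gsec_deg; rewrite memvN; exact: (lifts_deg hphi ht).
exists (inSub hR); apply/relation_variationP; exists theta => // n.
exact: fE.
Qed.

Lemma variation_linear a phi phi' (psi psi' : qN q -> qC q) :
  relation_variation mu phi psi -> relation_variation mu phi' psi' ->
  relation_variation mu (a *: phi + phi') (a *: psi + psi').
Proof.
move=> /relation_variationP[theta [tl tg tb] ht].
move=> /relation_variationP[theta' [tl' tg' tb'] ht'].
apply/relation_variationP; exists (fun m => a *: theta m + theta' m); first split.
- by move=> c x y; rewrite tl tl' !scalerDr !scalerA (mulrC a); coord_ring.
- by move=> u; rewrite tg tg' scaler0 addr0.
- move=> x y; rewrite tb tb' !lieDl !lieDr !lieZl !lieZr !scalerDr.
  by rewrite !fctE; coord_ring.
by move=> n; rewrite opprD -scalerN -ht -ht' -qemb_linear.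
Qed.

End RelationVariations.

(** * Coboundaries, orbit directions and derivations *)

Section TangentVectors.
Variables (k : fieldType) (g : vectType k) (mu : lieBracket g).
Variable L : nat -> {vspace g}.
Hypothesis hgrad : positive_grading mu L.
Hypothesis hmet : metabelian mu.
Hypothesis hgen : generated_by mu (fun x => x \in L 1%N).
Local Notation U := (subvs_of (L 1%N)).
Local Notation br := (metaLie_br U).
Local Notation univ := (@univ_map k g mu L).
Variables (h : nat -> nat) (q : quot_point U h).
Hypothesis hq : corresponds mu q.

Let ulin := univ_linear (L := L) hmet.
Let ubr := univ_br (L := L) hmet.
Let ugen := univ_gen (L := L) hmet.
Let s := gsec hgrad hmet hgen.
Let slin : linear s := gsec_linear hgrad hmet hgen.
Let sK x : univ (s x) = x := gsecK hgrad hmet hgen x.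
Local Notation qemb := (@qemb k g mu L h q).
Local Notation lifts := (@lifts k g mu L).

Lemma restrict_gen (f : g -> g) : C1_0 L f ->
  exists a : 'End(U), forall u, vsval (a u) = f (vsval u).
Proof.
move=> [fl fL].
have hl : linear (fun u : U => vsproj (L 1%N) (f (vsval u))).
  by move=> a u v; rewrite (linearP vsval) fl linearP.
exists (linfun (lin_pack hl)) => u; rewrite lfunE vsprojK //.
by apply: fL; exact: subvsP.
Qed.

Section Der.
Variable a : 'End(U).
Let al : linear a := linearP a.

Lemma qemb_dorb (n : qN q) : qemb (dorb_fun a n) = univ (metaLie_der a (val (val n))).
Proof. by rewrite qemb_qmap. Qed.

Lemma univ_der_deg i m : metaLie_deg U i m -> univ (metaLie_der a m) \in L i.
Proof. by move=> hm; apply: (univ_deg hgrad hmet); exact: metaLie_der_deg. Qed.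

Lemma univ_der_linear : linear (fun m => univ (metaLie_der a m)).
Proof. by move=> c x y; rewrite (metaLie_der_derivation al).1 ulin. Qed.

Lemma univ_der_br x y : univ (metaLie_der a (br x y)) =
  mu (univ (metaLie_der a x)) (univ y) + mu (univ x) (univ (metaLie_der a y)).
Proof. by rewrite (metaLie_der_derivation al).2 (linD ulin) !ubr. Qed.

Lemma univ_der_gen u : univ (metaLie_der a (metaLie_gen u)) = vsval (a u).
Proof. by rewrite metaLie_der_gen // ugen. Qed.
End Der.

(* id + eps f carries mu + eps (ce1 f) back to mu, so theta + f o univ is a
   derivation along univ, hence induced by an endomorphism of the generators. *)
Lemma variation_coboundary f (psi : qN q -> qC q) : C1_0 L f ->
  relation_variation mu (ce1 mu f) psi -> exists a : 'End(U), psi = dorb_fun a.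
Proof.
move=> hf /(relation_variationP hmet hq)[theta [tl tg tb] ht].
(* The sign compensates for [psi] embedding as -theta: the orbit direction of [a] is then [psi]
   itself. *)
have [|a ha] := @restrict_gen (fun x => - f x).
  exact: (subspN hf).
exists a; apply/funext => n; apply: (qemb_inj hmet hq).
rewrite ht qemb_dorb.
pose E m := theta m + univ (metaLie_der a m) + f (univ m).
have [fl _] := hf.
have El : linear E.
  move=> c x y; rewrite /E tl univ_der_linear ulin fl !scalerDr; coord_ring.
have E0 : forall m, E m = 0.
  apply: (derivation_along_eq0 (mu := mu) (p := univ) (p' := univ) El).
    move=> x y; rewrite /E tb univ_der_br ubr /ce1 !lieDr !lieDl.
    rewrite (lieC mu (f (univ x))); coord_ring.
  by move=> u; rewrite /E tg univ_der_gen ugen ha add0r addNr.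
have := E0 (val (val n)); rewrite /E univ_qN // (lin0 fl) addr0.
by move/eqP; rewrite addrC addr_eq0 => /eqP.
Qed.

(* theta + univ o a~ kills N, hence descends to g; up to sign this is the
   1-cochain bounding phi. *)
Lemma variation_dorb phi (a : 'End(U)) : C2_0 L phi ->
  relation_variation mu phi (dorb_fun (q := q) a) -> B2_0 mu L phi.
Proof.
move=> hphi /(relation_variationP hmet hq)[theta hl ht]; have [tl tg tb] := hl.
pose F m := - (theta m + univ (metaLie_der a m)).
have Fl : linear F.
  move=> c x y; rewrite /F tl univ_der_linear scalerN -opprD scalerDr; coord_ring.
have F0 m : univ m = 0 -> F m = 0.
  move=> /(qN_of hq)[n <-]; have := ht n; rewrite qemb_dorb /F => ->.
  by rewrite subrr oppr0.
have Fd i m : metaLie_deg U i m -> F m \in L i.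
  move=> hm; rewrite memvN memvD //; first exact: (lifts_deg hgrad hmet hphi hl hm).
  exact: univ_der_deg.
exists (fun x => F (s x)); first exact: (descend_cochain1 hgrad hmet hgen Fl Fd).
apply/funext => x; apply/funext => y.
change (phi x y = mu x (F (s y)) - mu y (F (s x)) - F (s (mu x y))).
(* The section is not a morphism, but its defect lies in the kernel of [univ], which F kills. *)
have -> : F (s (mu x y)) = F (br (s x) (s y)).
  by rewrite -(descend hgrad hmet hgen Fl F0 (br _ _)) ubr !sK.
rewrite /F tb univ_der_br !sK !lieNr !lieDr.
rewrite (lieC mu (theta _)) (lieC mu (univ (metaLie_der a (s x)))); coord_ring.
Qed.

(** * Every tangent vector comes from a deformation *)

Section Realization.
Variable psi : qN q -> qC q.
Hypothesis hpsi : homR0 q psi.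

Fact kernel_part_exists : exists f : metaLie U -> qN q,
  forall m, val (val (f m)) = m - s (univ m).
Proof.
have /choice[f hf] m : exists n : qN q, val (val n) = m - s (univ m).
  by apply: (qN_of hq); rewrite (linB ulin) sK subrr.
by exists f.
Qed.
Let kp := projT1 (cid kernel_part_exists).
Let kpE m : val (val (kp m)) = m - s (univ m) := projT2 (cid kernel_part_exists) m.

Lemma qN_inj (n n' : qN q) : val (val n) = val (val n') -> n = n'.
Proof. by move=> e; apply: val_inj; apply: val_inj. Qed.

(* M(U) is the direct sum of s(g) and N: extend - qemb o psi by zero on s(g). *)
Definition real_theta m := - qemb (psi (kp m)).
Local Notation theta := real_theta.

Lemma real_theta_linear : linear theta.
Proof.
have kl : linear kp.
  move=> a x y; apply: qN_inj.
  rewrite (@val_linear _ _ (qker q)) (@val_linear _ _ (derived br)) !kpE.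
  by rewrite ulin slin scalerBr opprD addrACA.
have [pl _ _] := hpsi.
by move=> a x y; rewrite /theta kl pl (qemb_linear hmet hq) opprD scalerN.
Qed.

Lemma real_theta_qN (n : qN q) : theta (val (val n)) = - qemb (psi n).
Proof.
rewrite /theta; congr (- qemb (psi _)); apply: qN_inj.
by rewrite kpE univ_qN // (lin0 slin) subr0.
Qed.

Lemma real_theta_sec x : theta (s x) = 0.
Proof.
have [pl _ _] := hpsi; rewrite /theta.
have -> : kp (s x) = 0 by apply: qN_inj; rewrite kpE sK subrr.
by rewrite (lin0 pl) (lin0 (qemb_linear hmet hq)) oppr0.
Qed.

Lemma real_theta_derived m : derived mu (theta m).
Proof.
apply: subspN; elim/proj_ind: (psi _) => b; rewrite -/(qmap q b) qemb_qmap //.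
exact: (univ_derived_B hgrad hmet hgen).
Qed.

Lemma real_theta_deg i m : metaLie_deg U i.+2 m -> theta m \in L i.+2.
Proof.
move=> hm; rewrite memvN; apply: (qemb_deg hgrad hmet hq).
have [_ _ pd] := hpsi; apply: pd => /=.
change (metaLie_deg U i.+2 (val (val (kp m)))); rewrite kpE.
apply: subspB => //; apply: gsec_deg; exact: (univ_deg hgrad hmet).
Qed.

(** The variable ['X_i] acts as the bracket with the i-th basis vector, so Sym(U)-linearity of [psi]
    gives the claim on a basis; both sides are linear in u. *)
Lemma real_theta_gen_br u (n : qN q) :
  theta (br (metaLie_gen u) (val (val n))) = mu (vsval u) (theta (val (val n))).
Proof.
have hL : linear (fun u => theta (br (metaLie_gen u) (val (val n)))).
  move=> a v w; rewrite metaLie_gen_linear lieDl lieZl; exact: real_theta_linear.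
have hR : linear (fun u : U => mu (vsval u) (theta (val (val n)))).
  by move=> a v w; rewrite (linearP vsval) lieDl lieZl.
rewrite (coord_vbasis (memvf u)) (lin_sum hL) (lin_sum hR).
apply: eq_bigr => i _; rewrite (linZ hL) (linZ hR); congr (_ *: _).
have [_ pR _] := hpsi.
have e : val (val (qN_act 'X_i n)) = br (metaLie_gen (vbasis {:U})`_i) (val (val n)).
  by rewrite /= sym_act_mnm1.
rewrite -e !real_theta_qN pR /qC_act sym_act_mnm1 (qemb_uact hmet hq).
by rewrite lieNr.
Qed.

(** Split m into a generator and an element b of B(U). The part b contributes 0 on both sides, since
    M(U) and g are metabelian. *)
Lemma real_theta_br m (n : qN q) :
  theta (br m (val (val n))) = mu (univ m) (theta (val (val n))).
Proof.
have [u [b ->]] := metaLie_decomp m.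
rewrite lieDl (linD real_theta_linear) real_theta_gen_br (linD ulin) ugen lieDl.
congr (_ + _).
have /metabelianP -> := @metaLie_metabelian k U; try exact: subTP.
rewrite (lin0 real_theta_linear).
have /metabelianP -> // := hmet; last exact: real_theta_derived.
exact: (univ_derived_B hgrad hmet hgen).
Qed.

(** As [theta] vanishes on s(g), the bracket rule at s(x) and s(y) forces this value. *)
Definition real_cochain x y := theta (br (s x) (s y)).

(** Each argument is split along s(g) + N. Brackets with a component in N are governed by
    [real_theta_br], and the bracket of two such components contributes 0. *)
Lemma real_cochain_lifts : lifts real_cochain theta.
Proof.
split; first exact: real_theta_linear.
  by move=> u; rewrite -(gsec_gen hgrad hmet hgen) real_theta_sec.
move=> a b; rewrite /real_cochain.
have da m : m = s (univ m) + val (val (kp m)) by rewrite kpE addrC subrK.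
have ta m : theta m = theta (val (val (kp m))).
  by rewrite {1}(da m) (linD real_theta_linear) real_theta_sec add0r.
rewrite (ta a) (ta b) {1}(da a) {1}(da b) lieDl !lieDr.
rewrite !(linD real_theta_linear) !real_theta_br sK univ_qN // lie0l addr0.
rewrite (lieC br (val _)) (linN real_theta_linear) real_theta_br sK.
by rewrite -(lieC mu (theta _)); coord_ring.
Qed.

Lemma real_cochain_deformation : metabelian_deformation mu L real_cochain.
Proof.
have hphi : C2_0 L real_cochain.
  split.
  - move=> y a x x'; rewrite /real_cochain slin lieDl lieZl; exact: real_theta_linear.
  - move=> x a y y'; rewrite /real_cochain slin lieDr lieZr; exact: real_theta_linear.
  - by move=> x; rewrite /real_cochain lie_alt (lin0 real_theta_linear).
  (* Degree-0 arguments are zero; otherwise the total degree is at least 2, as [real_theta_deg]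
     requires. *)
  - move=> [|i] [|j] x y hx hy; rewrite /real_cochain.
    + by rewrite (graded_0 hgrad hx) (lin0 slin) lie0l (lin0 real_theta_linear) mem0v.
    + by rewrite (graded_0 hgrad hx) (lin0 slin) lie0l (lin0 real_theta_linear) mem0v.
    + by rewrite (graded_0 hgrad hy) (lin0 slin) lie0r (lin0 real_theta_linear) mem0v.
    rewrite addSn addnS; apply: real_theta_deg; rewrite -addnS -addSn.
    by apply: metaLie_deg_br; exact: gsec_deg.
have [_ _ tb] := real_cochain_lifts.
apply/(metabelian_deformationP hgrad hmet hgen); split; last first.
  move=> x y hx hy; rewrite /real_cochain.
  have /metabelianP -> := @metaLie_metabelian k U; try exact: gsec_derived.
  exact: (lin0 real_theta_linear).
split=> //; apply/funext => x; apply/funext => y; apply/funext => z.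
change (ce2 mu real_cochain x y z = 0); rewrite (ce2_cyclic mu x y z hphi).
(* Each cyclic term is [theta] of an iterated bracket of sections, so the cocycle identity is
   [theta] applied to the Jacobi identity in M(U). *)
have c x' y' z' : mu x' (real_cochain y' z') + real_cochain x' (mu y' z')
    = theta (br (s x') (br (s y') (s z'))).
  by rewrite tb real_theta_sec lie0l addr0 ubr !sK.
have := lie_jacobi br (s x) (s y) (s z).
move/(congr1 theta); rewrite !(linD real_theta_linear) (lin0 real_theta_linear) -!c.
by move=> e; apply: etrans e; coord_ring.
Qed.

Lemma variation_surjective : exists2 phi,
  metabelian_deformation mu L phi & relation_variation mu phi psi.
Proof.
exists real_cochain; first exact: real_cochain_deformation.
apply/(relation_variationP hmet hq); exists theta; first exact: real_cochain_lifts.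
by move=> n; rewrite real_theta_qN opprK.
Qed.
End Realization.

(** The two sides differ by a derivation along [univ] that vanishes on generators. *)
Lemma univ_der_restrict (D : g -> g) (a : 'End(U)) : derivation mu D ->
  (forall u, vsval (a u) = D (vsval u)) ->
  forall m, univ (metaLie_der a m) = D (univ m).
Proof.
move=> [Dl Db] ha m; apply/eqP; rewrite -subr_eq0; apply/eqP; move: m.
apply: (derivation_along_eq0 (mu := mu) (p := univ) (p' := univ)).
- by move=> c x y; rewrite univ_der_linear ulin Dl scalerBr opprD addrACA.
- move=> x y; rewrite univ_der_br ubr Db lieDr lieDl lieNr lieNl; coord_ring.
- by move=> u; rewrite univ_der_gen ugen ha subrr.
Qed.

Lemma derivation_dorb (D : g -> g) (a : 'End(U)) : derivation mu D ->
  (forall u, vsval (a u) = D (vsval u)) -> dorb q a = 0.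
Proof.
move=> hD ha; apply: val_inj; apply/funext => n; apply: (qemb_inj hmet hq).
change (qemb (dorb_fun a n) = qemb 0).
rewrite qemb_dorb (univ_der_restrict hD ha) univ_qN // (lin0 hD.1).
by rewrite (lin0 (qemb_linear hmet hq)).
Qed.

(** Vanishing of the orbit direction says that univ o a~ kills N, so it descends through the section
    to a derivation of g. *)
Lemma dorb_derivation (a : 'End(U)) : dorb q a = 0 ->
  exists2 D, Der_0 mu L D & forall u, vsval (a u) = D (vsval u).
Proof.
move=> ha; pose F m := univ (metaLie_der a m).
have Fl : linear F := univ_der_linear a.
have F0 m : univ m = 0 -> F m = 0.
  move=> /(qN_of hq)[n <-]; rewrite /F -qemb_dorb.
  have -> : dorb_fun a n = val (dorb q a) n by [].
  by rewrite ha (lin0 (qemb_linear hmet hq)).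
have hF := descend hgrad hmet hgen Fl F0.
exists (fun x => F (s x)); last first.
  by move=> u; rewrite -[in RHS]ugen [RHS]hF /F univ_der_gen.
have hC : C1_0 L (fun x => F (s x)).
  by apply: (descend_cochain1 hgrad hmet hgen Fl) => i m; exact: univ_der_deg.
split=> //; split=> [|x y]; first by case: hC.
have -> : mu x y = univ (br (s x) (s y)) by rewrite ubr !sK.
by rewrite [LHS]hF /F univ_der_br !sK.
Qed.

Lemma derivation_eq0 (D : g -> g) : derivation mu D ->
  (forall x, x \in L 1%N -> D x = 0) -> D = 0.
Proof.
move=> [Dl Db] D1; apply/funext => x; apply: (hgen (X := ker (lin_pack Dl))) => //.
by move=> y z /= hy hz; rewrite Db hy hz lie0l lie0r addr0.
Qed.
End TangentVectors.

(** * The identifications *)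

Section Identification.
Variables (k : fieldType) (g : vectType k) (mu : lieBracket g).
Variable L : nat -> {vspace g}.
Hypothesis hgrad : positive_grading mu L.
Hypothesis hmet : metabelian mu.
Hypothesis hgen : generated_by mu (fun x => x \in L 1%N).
Local Notation U := (subvs_of (L 1%N)).
Variables (h : nat -> nat) (q : quot_point U h).
Hypothesis hq : corresponds mu q.

Lemma H2_0_class_eq0 (phi : subT (Z2_0 mu L)) :
  H2_0_class phi = 0 <-> B2_0 mu L (val phi).
Proof.
by rewrite -(linear0 (quot_proj (B2_0_in_Z2_0 mu L))) projP subr0.
Qed.

Lemma H0_class_eq0 (psi : subT (homR0 q)) :
  H0_class (T := tangent_complex q) psi = 0 <-> exists a, psi = dorb q a.
Proof.
rewrite -[X in _ = X](linear0 (quot_proj (Defs.image (tt_d (tangent_complex q)) fullsp))).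
rewrite projP subr0; split=> [[a _ ->]|[a ->]]; by exists a.
Qed.

Lemma deformation_identification
    (Delta : {linear H2_0 mu L -> subT (hom_L2d mu L)}) :
  (forall phi : subT (Z2_0 mu L),
     ker Delta (H2_0_class phi) <-> vanishes_on_L2d mu (val phi)) ->
  exists2 Theta : {linear subT (ker Delta) -> H0 (tangent_complex q)},
    bijective Theta
    & forall (c : subT (ker Delta)) (phi : subT (Z2_0 mu L)),
        val c = H2_0_class phi ->
        exists2 psi : subT (homR0 q),
          relation_variation mu (val phi) (val psi)
          & Theta c = H0_class (T := tangent_complex q) psi.
Proof.
move=> hD.
have hdef (c : subT (ker Delta)) (phi : subT (Z2_0 mu L)) :
    val c = H2_0_class phi -> metabelian_deformation mu L (val phi).
  move=> e; apply/(metabelian_deformationP hgrad hmet hgen).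
  split; first exact: subTP.
  by apply/hD; rewrite -e; exact: subTP.
have hrep (c : subT (ker Delta)) : exists phi, val c = H2_0_class phi.
  by exists (repr (val c)); rewrite /H2_0_class /quot_proj reprK.
(* The relation ranges over all representing cocycles and all their variations, so nothing is chosen
   before well-definedness is known. *)
pose R (c : subT (ker Delta)) (y : H0 (tangent_complex q)) :=
  exists (phi : subT (Z2_0 mu L)) (psi : subT (homR0 q)),
    [/\ val c = H2_0_class phi, relation_variation mu (val phi) (val psi)
      & y = H0_class (T := tangent_complex q) psi].
have Rex (c : subT (ker Delta)) (phi : subT (Z2_0 mu L)) :
    val c = H2_0_class phi -> exists2 psi : subT (homR0 q),
      relation_variation mu (val phi) (val psi)
      & R c (H0_class (T := tangent_complex q) psi).
  move=> e; have [psi hpsi] := variation_exists hgrad hmet hgen hq (hdef _ _ e).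
  by exists psi => //; exists phi, psi.
have Rtot c : exists y, R c y.
  have [phi /Rex[psi _ hR]] := hrep c; by exists (H0_class (T := tangent_complex q) psi).
(* Well-definedness: a coboundary moves the relation module along the orbit. *)
have R0 y : R 0 y -> y = 0.
  move=> [phi [psi [/esym/H2_0_class_eq0[f hf e] hpsi ->]]].
  apply/H0_class_eq0; rewrite e in hpsi.
  have [a ea] := variation_coboundary hmet hq hf hpsi.
  by exists a; apply: val_inj.
have Rlin a c y c' y' : R c y -> R c' y' -> R (a *: c + c') (a *: y + y').
  move=> [phi [psi [e hpsi ->]]] [phi' [psi' [e' hpsi' ->]]].
  exists (a *: phi + phi'), (a *: psi + psi'); split.
  - by rewrite (@val_linear _ _ (ker Delta)) e e' /H2_0_class linearP.
  - rewrite (@val_linear _ _ (Z2_0 mu L)) (@val_linear _ _ (homR0 q)).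
    exact: (variation_linear hmet hq).
  - by rewrite /H0_class linearP.
have [Theta hT] := linear_of_graph Rtot R0 Rlin.
exists Theta; last first.
  by move=> c phi /Rex[psi hpsi /hT e]; exists psi.
apply: linear_bijective => [c hc|y].
  (* Injectivity: if the variation is an orbit direction, the cocycle is a coboundary. *)
  have [phi e] := hrep c; have [psi hpsi /hT] := Rex _ _ e.
  rewrite hc => /H0_class_eq0[a ea]; rewrite ea in hpsi.
  apply: val_inj; rewrite e; apply/H2_0_class_eq0.
  have hphi : C2_0 L (val phi) by case: (hdef _ _ e).
  exact: (variation_dorb hgrad hmet hgen hq hphi hpsi).
elim/proj_ind: y => psi.
(* Surjectivity: the realized cocycle vanishes on pairs from g', so its class lies in the kernel of
   [Delta]. *)
have [phi hphi hpsi] := variation_surjective hgrad hmet hgen hq (subTP psi).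
have [hZ hv] := (metabelian_deformationP hgrad hmet hgen phi).1 hphi.
have hc : ker Delta (H2_0_class (inSub hZ)) by apply/hD.
exists (inSub hc); apply/esym/hT; by exists (inSub hZ), psi.
Qed.

(** The map restricts a derivation to L_1: generation by L_1 makes it injective, and descent of
    stabilizer elements to g makes it surjective. *)
Lemma derivation_identification :
  exists2 rho : {linear subT (Der_0 mu L) -> Hm1 (tangent_complex q)},
    bijective rho
    & forall (D : subT (Der_0 mu L)) (u : U),
        vsval ((val (rho D) : 'End(U)) u) = val D (vsval u).
Proof.
pose K := ker (tt_d (tangent_complex q)).
pose R (D : subT (Der_0 mu L)) (a : subT K) :=
  forall u : U, vsval ((val a : 'End(U)) u) = val D (vsval u).
have Rtot D : exists a, R D a.
  have [hC hD] := subTP D.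
  have [a ha] := restrict_gen hC.
  have hK : K a := derivation_dorb hmet hq hD ha.
  by exists (inSub hK).
have R0 a : R 0 a -> a = 0.
  move=> h0; apply: val_inj; apply/lfunP => u.
  by rewrite zero_lfunE; apply: subvs_inj; rewrite linear0; exact: h0.
have Rlin c D a D' a' : R D a -> R D' a' -> R (c *: D + D') (c *: a + a').
  move=> ha ha' u; rewrite (@val_linear _ _ K) (@val_linear _ _ (Der_0 mu L)).
  change (vsval ((c *: (val a : 'End(U)) + (val a' : 'End(U))) u)
    = c *: val D (vsval u) + val D' (vsval u)).
  rewrite add_lfunE scale_lfunE (linearP vsval).
  by congr (_ *: _ + _); [exact: ha|exact: ha'].
have [rho hrho] := linear_of_graph Rtot R0 Rlin.
exists rho; last by move=> D; exact/(hrho D).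
apply: linear_bijective => [D e|a].
  have [_ hD] := subTP D; apply: val_inj.
  apply: (derivation_eq0 hgen hD) => x hx.
  have /(_ (vsproj (L 1%N) x)) := (hrho D 0).2 (esym e).
  by rewrite vsprojK // => <-; rewrite zero_lfunE linear0.
have [D hD ha] := dorb_derivation hgrad hmet hgen hq (subTP a).
by exists (inSub hD); apply/esym/hrho.
Qed.
End Identification.

Theorem theorem2p7 (k : fieldType) (hchar : [pchar k] =i pred0)
    (g : vectType k) (mu : lieBracket g) (L : nat -> {vspace g})
    (hgrad : positive_grading mu L) (hmet : metabelian mu)
    (hgen : generated_by mu (fun x => x \in L 1%N)) :
  (forall x, derived mu x <-> exists n, x \in (\sum_(2 <= i < n) L i)%VS) /\
  exists Delta : {linear H2_0 mu L -> subT (hom_L2d mu L)},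
  [/\ forall (phi : subT (Z2_0 mu L)) (x y : subT (derived mu)),
        val (Delta (H2_0_class phi)) x y = val phi (val x) (val y),
      (forall phi, B2_0 mu L phi ->
         Z2_0 mu L phi /\ vanishes_on_L2d mu phi) /\
      (forall c, ker Delta c <->
         exists2 phi : subT (Z2_0 mu L),
           vanishes_on_L2d mu (val phi) & c = H2_0_class phi),
      (forall phi, metabelian_deformation mu L phi <->
         Z2_0 mu L phi /\ vanishes_on_L2d mu phi),
      (forall phi phi', metabelian_deformation mu L phi ->
         metabelian_deformation mu L phi' ->
         (equiv_deformation mu L phi phi' <-> B2_0 mu L (phi - phi')))
    & forall (h : nat -> nat) (q : quot_point (subvs_of (L 1%N)) h),
        corresponds mu q ->
        (exists2 Theta : {linear subT (ker Delta) -> H0 (tangent_complex q)},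
           bijective Theta
           & forall (c : subT (ker Delta)) (phi : subT (Z2_0 mu L)),
               val c = H2_0_class phi ->
               exists2 psi : subT (homR0 q),
                 relation_variation mu (val phi) (val psi)
                 & Theta c = H0_class (T := tangent_complex q) psi) /\
        (exists2 rho : {linear subT (Der_0 mu L) -> Hm1 (tangent_complex q)},
           bijective rho
           & forall (D : subT (Der_0 mu L)) (u : subvs_of (L 1%N)),
               vsval ((val (rho D) : 'End(subvs_of (L 1%N))) u) = val D (vsval u))].
Proof.
split=> [x|]; first exact: (derived_sum hgrad hgen).
have [Delta hDelta] := restriction_exists hgrad hmet hgen.
have hker := ker_restriction hDelta.
exists Delta; split=> //.
- split=> [phi|c]; first exact: (B2_vanishes hgrad hmet hgen).
  split=> [hc|[phi hphi ->]]; last exact/hker.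
  exists (repr c); last by rewrite /H2_0_class /quot_proj reprK.
  by apply/hker; rewrite /H2_0_class /quot_proj reprK.
- exact: (metabelian_deformationP hgrad hmet hgen).
- by move=> phi phi' _ _; exact: equiv_deformationP.
- move=> h q hq; split; first exact: (deformation_identification hgrad hmet hgen hq hker).
  exact: (derivation_identification hgrad hmet hgen hq).
Qed.
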